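(* Let $\alpha,d\in\mathbb{N}$. Suppose that for every $\ell\ge1$ the univariate Gauss--Hermite rule $Q^{\mathrm{uni}}_\ell$ employs $n_\ell$ quadrature points, where $n_\ell\ne n_{\ell'}$ whenever $\ell\ne\ell'$ and, for some $M_0>0$ and $M>1$, $$M^{\ell-1}\le n_\ell\le M_0(M^\ell-1),\qquad \ell\ge1.$$ For an integer $L\ge d$ let $\Lambda_L=\{\boldsymbol{\ell}\in\mathbb{N}^d:\ \ell_1+\dots+\ell_d\le L\}$, let $S_{\Lambda_L}$ be the sparse-grid quadrature based on the Gauss--Hermite rule, and let $N$ denote the total number of function evaluations used in $S_{\Lambda_L}$. Then $$\sup_{0\neq f\in H^\alpha_\rho(\mathbb{R}^d)}\frac{|I(f)-S_{\Lambda_L}(f)|}{\|f\|_{H^\alpha_\rho(\mathbb{R}^d)}}\ \ge\ c_{\alpha,d}\,N^{-\alpha/2}(\ln N)^{\frac{\alpha}{2}(d-1)},$$ where the constant $c_{\alpha,d}>0$ is independent of $N$ (and $L$), but may depend on $M,M_0$.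
   Context: $\mathbb{N}=\{1,2,\dots\}$. Let $\rho(\boldsymbol{x})=(2\pi)^{-d/2}e^{-|\boldsymbol{x}|_2^2/2}$ be the standard Gaussian density on $\mathbb{R}^d$, and $I(f)=\int_{\mathbb{R}^d}f(\boldsymbol{x})\rho(\boldsymbol{x})\,d\boldsymbol{x}$. $L^2_\rho(\mathbb{R}^d)$ is the $L^2$ space with respect to $\rho\,d\boldsymbol{x}$. The Gaussian Sobolev space $H^\alpha_\rho(\mathbb{R}^d)$ of dominating mixed smoothness $\alpha$ consists of all $f$ whose weak derivatives $D^{\mathbf{r}}f$ lie in $L^2_\rho(\mathbb{R}^d)$ for all $\mathbf{r}\in\mathbb{N}_0^d$ with $|\mathbf{r}|_\infty\le\alpha$, with norm $\|f\|_{H^\alpha_\rho(\mathbb{R}^d)}=\big(\sum_{|\mathbf{r}|_\infty\le\alpha}\|D^{\mathbf{r}}f\|^2_{L^2_\rho(\mathbb{R}^d)}\big)^{1/2}$. Functions in this space have continuous representatives, at which point evaluations are taken. For $\ell\ge1$, $Q^{\mathrm{uni}}_\ell$ is the univariate Gauss--Hermite rule with $n_\ell\in\mathbb{N}$ nodes, i.e. the Gauss quadrature $Q^{\mathrm{uni}}_\ell(g)=\sum_{i=1}^{n_\ell}w_ig(\xi_i)$ for the standard Gaussian weight on $\mathbb{R}$, whose nodes are the zeros of the probabilists' Hermite polynomial of degree $n_\ell$ and which is exact for polynomials of degree at most $2n_\ell-1$. Put $Q^{\mathrm{uni}}_0=0$, $\Delta_0=0$ and $\Delta_\ell=Q^{\mathrm{uni}}_\ell-Q^{\mathrm{uni}}_{\ell-1}$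 for $\ell\ge1$. For finite $\Lambda\subset\mathbb{N}^d$ the sparse-grid quadrature is $$S_\Lambda=\sum_{(\ell_1,\dots,\ell_d)\in\Lambda}\Delta_{\ell_1}\otimes\cdots\otimes\Delta_{\ell_d},$$ where the tensor product of univariate functionals $\sum_i w^{(j)}_i\,\delta_{x^{(j)}_i}$, $j=1,\dots,d$, is $f\mapsto\sum_{i_1,\dots,i_d}w^{(1)}_{i_1}\cdots w^{(d)}_{i_d}f(x^{(1)}_{i_1},\dots,x^{(d)}_{i_d})$. $N$ is the number of distinct points of the grid, i.e. $N=\#\bigcup_{\boldsymbol{\ell}\in\Lambda_L}X_{\ell_1}\times\cdots\times X_{\ell_d}$ with $X_\ell$ the node set of $Q^{\mathrm{uni}}_\ell$. *)

(* Defs.v *)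
From HB Require Import structures.
From mathcomp Require Import all_boot all_order all_algebra finmap.
From mathcomp Require Import all_classical all_reals all_analysis.

Set Implicit Arguments.
Unset Strict Implicit.
Unset Printing Implicit Defensive.
Import Order.TTheory GRing.Theory Num.Theory.
Import numFieldNormedType.Exports.

Local Open Scope classical_set_scope.
Local Open Scope ring_scope.

(* R^d is 'rV[R]_d, with the sigma-algebra generated by the coordinates,
   which is the Borel sigma-algebra of R^d. *)
Section measurable_row.
Context {d : measure_display} {T : measurableType d}.
Variable n : nat.

Definition row_coord (i : 'I_n) (x : 'rV[T]_n) : T := x ord0 i.

Let row_set0 : g_sigma_preimage row_coord set0.
Proof. exact: sigma_algebra0. Qed.

Let row_setC A : g_sigma_preimage row_coord A ->
  g_sigma_preimage row_coord (~` A).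
Proof. exact: sigma_algebraC. Qed.

Let row_bigcup (F : _^nat) : (forall i, g_sigma_preimage row_coord (F i)) ->
  g_sigma_preimage row_coord (\bigcup_i (F i)).
Proof. exact: sigma_algebra_bigcup. Qed.

HB.instance Definition _ := @isMeasurable.Build (measure_tuple_display d)
  'rV[T]_n (g_sigma_preimage row_coord) row_set0 row_setC row_bigcup.

Lemma measurable_row_coord (i : 'I_n) : measurable_fun setT (row_coord i).
Proof.
move=> _ Y mY; rewrite setTI; apply: sub_sigma_algebra => /=.
rewrite -bigcup_seq/=; exists i => /=; first by rewrite mem_index_enum.
by exists Y => //; rewrite setTI.
Qed.

Lemma measurable_fun_rowP (d' : measure_display) (T' : measurableType d')
    (f : T' -> 'rV[T]_n) :
  (forall i, measurable_fun setT (row_coord i \o f)) -> measurable_fun setT f.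
Proof.
move=> mf _ A mA; rewrite setTI.
have : preimage_set_system setT f (g_sigma_preimage row_coord) (f @^-1` A).
  by exists A => //; rewrite setTI.
rewrite -g_sigma_preimageE; apply: smallest_sub.
  exact: sigma_algebra_measurable.
move=> _ [B + <-]; rewrite -bigcup_seq => -[i _ [C mC <-]].
by rewrite !setTI -comp_preimage -[X in measurable X]setTI; exact: mf.
Qed.

End measurable_row.

Section lebesgue_row.
Context {R : realType}.
Local Notation RT := (measurableTypeR R).

Definition row_cons n (p : RT * 'rV[RT]_n) : 'rV[RT]_n.+1 :=
  row_mx (\row_(_ < 1) p.1) p.2.

Lemma row_cons0 n (p : RT * 'rV[RT]_n) : row_cons p ord0 ord0 = p.1.
Proof.
have := row_mxEl (\row_(_ < 1) p.1) p.2 ord0 (ord0 : 'I_1).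
by rewrite mxE => <-; congr (row_cons _ _ _); exact: val_inj.
Qed.

Lemma row_consS n (p : RT * 'rV[RT]_n) (i : 'I_n) :
  row_cons p ord0 (lift ord0 i) = p.2 ord0 i.
Proof.
have := row_mxEr (\row_(_ < 1) p.1) p.2 ord0 i.
by move=> <-; congr (row_cons _ _ _); exact: val_inj.
Qed.

Lemma measurable_row_cons n : measurable_fun setT (@row_cons n).
Proof.
apply: measurable_fun_rowP => i.
case: (fintype.unliftP ord0 i) => [j ->|->].
  rewrite (_ : _ \o _ = row_coord j \o snd); last first.
    by apply/funext => p /=; rewrite /row_coord row_consS.
  by apply: measurableT_comp; [exact: measurable_row_coord|].
rewrite (_ : _ \o _ = fst) //.
by apply/funext => p /=; rewrite /row_coord row_cons0.
Qed.

Definition row_uncons n (x : 'rV[RT]_n.+1) : RT * 'rV[RT]_n :=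
  (x ord0 ord0, \row_i x ord0 (lift ord0 i)).

Lemma row_consK n : cancel (@row_cons n) (@row_uncons n).
Proof.
move=> [x y]; rewrite /row_uncons row_cons0; congr pair.
by apply/rowP => i; rewrite mxE row_consS.
Qed.

Lemma measurable_row_uncons n : measurable_fun setT (@row_uncons n).
Proof.
apply/measurable_fun_pairP; split; first exact: measurable_row_coord.
apply: measurable_fun_rowP => i.
rewrite (_ : _ \o _ = row_coord (lift ord0 i)); first exact: measurable_row_coord.
by apply/funext => x; rewrite /row_coord /= mxE.
Qed.

Section step.
Variables (n : nat) (mu : {sigma_finite_measure set 'rV[RT]_n -> \bar R}).

Definition lebesgue_row_step : set 'rV[RT]_n.+1 -> \bar R :=
  pushforward (@lebesgue_measure R \x mu)%E (@row_cons n).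

Let step0 : lebesgue_row_step set0 = 0%E.
Proof. by rewrite /lebesgue_row_step /pushforward preimage_set0 measure0. Qed.

Let step_ge0 A : (0 <= lebesgue_row_step A)%E.
Proof. by rewrite /lebesgue_row_step /pushforward; exact: measure_ge0. Qed.

Let step_sigma_additive : semi_sigma_additive lebesgue_row_step.
Proof.
have mc A : measurable A -> measurable (@row_cons n @^-1` A).
  by move=> mA; rewrite -[X in measurable X]setTI; exact: measurable_row_cons.
move=> F mF tF mUF; rewrite /lebesgue_row_step /pushforward preimage_bigcup.
apply: measure_semi_sigma_additive.
- by move=> k; exact: mc.
- apply/trivIsetP => /= i j _ _ ij; rewrite -preimage_setI.
  by move/trivIsetP : tF => /(_ _ _ _ _ ij) ->//; rewrite preimage_set0.
- by rewrite -preimage_bigcup; exact: mc.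
Qed.

HB.instance Definition _ := isMeasure.Build _ _ _ lebesgue_row_step
  step0 step_ge0 step_sigma_additive.

Let step_sigma_finite : sigma_finite setT lebesgue_row_step.
Proof.
have [F FT Foo] : sigma_finite setT (@lebesgue_measure R \x mu)%E.
  have /sigma_finiteP[F [TF ndF Foo]] := sigma_finiteT (@lebesgue_measure R).
  have /sigma_finiteP[G [TG ndG Goo]] := sigma_finiteT mu.
  exists (fun k => F k `*` G k).
    rewrite -setXTT TF TG predeqE => -[x y]; split.
      move=> [/= [k _ Fnx] [l _ Gky]]; exists (maxn k l) => //; split.
      - by move: x Fnx; exact/subsetPset/ndF/leq_maxl.
      - by move: y Gky; exact/subsetPset/ndG/leq_maxr.
    by move=> [k _ []/= ? ?]; split; exists k.
  move=> k; have [? ?] := Foo k; have [? ?] := Goo k.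
  split; first exact: measurableX.
  by rewrite product_measure1E// lte_mul_pinfty// ge0_fin_numE.
exists (fun k => @row_uncons n @^-1` F k).
  by rewrite -preimage_bigcup -FT preimage_setT.
move=> k; have [mF Fk] := Foo k; split.
  by rewrite -[X in measurable X]setTI; exact: measurable_row_uncons.
rewrite /lebesgue_row_step /pushforward -comp_preimage.
rewrite (_ : _ @^-1` _ = F k)//.
by apply/seteqP; split => p /=; rewrite row_consK.
Qed.

HB.instance Definition _ := Measure_isSigmaFinite.Build _ _ _
  lebesgue_row_step step_sigma_finite.

End step.

(* The Lebesgue measure of R^n, as the n-fold product of the Lebesgue measure
   of R; on R^0, which is a point, it is the unit mass. *)
Fixpoint lebesgue_row n : {sigma_finite_measure set 'rV[RT]_n -> \bar R} :=
  if n is n'.+1 then lebesgue_row_step (lebesgue_row n') else \d_(0 : 'rV[RT]_0).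

End lebesgue_row.

Section gaussian_sobolev.
Context {R : realType} {d : nat}.
Local Notation leb := (@lebesgue_row R d).
Implicit Types (f g phi : 'rV[R]_d -> R) (r : 'I_d -> nat).

Definition gauss_density (x : 'rV[R]_d) : R :=
  (2 * pi) `^ (- (d%:R / 2)) * expR (- (\sum_i x ord0 i ^+ 2) / 2).

Definition gauss_int f : R := \int[leb]_x (f x * gauss_density x).

Definition L2gauss g : Prop :=
  measurable_fun setT g /\
  leb.-integrable setT (fun x => (g x ^+ 2 * gauss_density x)%:E).

Definition L2gauss_norm g : R :=
  Num.sqrt (\int[leb]_x (g x ^+ 2 * gauss_density x)).

Definition unit_row (i : 'I_d) : 'rV[R]_d := delta_mx ord0 i.

Definition iter_partial (s : seq 'I_d) phi : 'rV[R]_d -> R :=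
  foldr (fun i h => 'D_(unit_row i) h) phi s.

(* C^oo: all iterated partial derivatives exist and are continuous. *)
Definition smooth phi : Prop := forall s : seq 'I_d,
  continuous (iter_partial s phi) /\
  forall i x, derivable (iter_partial s phi) x (unit_row i).

Definition test_function phi : Prop :=
  smooth phi /\ compact (closure [set x | phi x != 0]).

Definition multi_partial r phi : 'rV[R]_d -> R :=
  iter_partial (flatten [seq nseq (r i) i | i <- enum 'I_d]) phi.

Definition loc_integrable g : Prop :=
  measurable_fun setT g /\
  forall K : set 'rV[R]_d, compact K -> (\int[leb]_(x in K) `|g x|%:E < +oo)%E.

Definition is_weak_deriv r f g : Prop :=
  loc_integrable g /\
  forall phi, test_function phi ->
    \int[leb]_x (f x * multi_partial r phi x) =
    (-1) ^+ (\sum_i r i) * \int[leb]_x (g x * phi x).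

(* A weak derivative is unique up to a null set, so L2 norms do not depend on
   the version that [get] selects. *)
Definition weak_deriv r f : 'rV[R]_d -> R := get (is_weak_deriv r f).

(* The multi-indices r with |r|_oo <= a are the functions 'I_d -> 'I_a.+1.
   An element of the space is represented by its continuous representative. *)
Definition gauss_sobolev (a : nat) f : Prop :=
  continuous f /\
  forall r : {ffun 'I_d -> 'I_a.+1},
    exists2 g, is_weak_deriv (fun i => r i) f g & L2gauss g.

Definition gauss_sobolev_norm (a : nat) f : R :=
  Num.sqrt (\sum_(r : {ffun 'I_d -> 'I_a.+1})
    L2gauss_norm (weak_deriv (fun i => r i) f) ^+ 2).

Definition worst_case_error (a : nat) (S : ('rV[R]_d -> R) -> R) : \bar R :=
  ereal_sup [set (`|gauss_int f - S f| / gauss_sobolev_norm a f)%:E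
            | f in [set f | gauss_sobolev a f /\ f <> cst 0]].

End gaussian_sobolev.

Section sparse_grid.
Context {R : realType}.

(* The probabilists' Hermite polynomials. *)
Fixpoint hermite (n : nat) : {poly R} :=
  if n is n'.+1 then
    if n' is n''.+1 then 'X * hermite n' - n'%:R *: hermite n'' else 'X
  else 1.

(* A finite sum of weighted point evaluations on R, as a list of pairs
   (weight, point). *)
Definition rule : Type := seq (R * R).

Definition nodes (q : rule) : seq R := [seq p.2 | p <- q].

Definition rule_eval (q : rule) (g : R -> R) : R :=
  \sum_(p <- q) p.1 * g p.2.

Definition rule_opp (q : rule) : rule := [seq (- p.1, p.2) | p <- q].

Definition gauss_hermite (n : nat) (q : rule) : Prop :=
  [/\ size q = n, uniq (nodes q),
      forall x, (x \in nodes q) = root (hermite n) x &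
      forall p : {poly R}, (size p <= 2 * n)%N ->
        rule_eval q (fun x => p.[x]) =
        \int[@lebesgue_measure R]_x (p.[x] * normal_pdf 0 1 x)].

(* Level 0 is the zero functional, whatever Q 0 is. *)
Definition level (Q : nat -> rule) (l : nat) : rule :=
  if l is 0 then [::] else Q l.

Definition Delta (Q : nat -> rule) (l : nat) : rule :=
  if l is l'.+1 then level Q l ++ rule_opp (level Q l') else [::].

Definition tensor_eval (d : nat) (q : 'I_d -> rule) (f : 'rV[R]_d -> R) : R :=
  \sum_(i : {dffun forall j : 'I_d, 'I_(size (q j))})
    (\prod_j (nth 0 (q j) (i j)).1) * f (\row_j (nth 0 (q j) (i j)).2).

(* A finite set of levels in N^d is a set of functions into some 'I_K. *)
Definition sparse_quad (d K : nat) (Q : nat -> rule)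
    (Lam : {set {ffun 'I_d -> 'I_K}}) (f : 'rV[R]_d -> R) : R :=
  \sum_(l in Lam) tensor_eval (fun j => Delta Q (l j)) f.

(* The bound 'I_L.+1 loses nothing: the entries are at most their sum. *)
Definition simplex_levels (d L : nat) : {set {ffun 'I_d -> 'I_L.+1}} :=
  [set l : {ffun 'I_d -> 'I_L.+1} |
    [forall j, 0 < l j]%N && (\sum_j l j <= L)%N]%SET.

Definition grid_points (d K : nat) (Q : nat -> rule)
    (Lam : {set {ffun 'I_d -> 'I_K}}) : set 'rV[R]_d :=
  \bigcup_(l in [set` Lam])
    [set x : 'rV[R]_d | forall j, x ord0 j \in nodes (Q (l j))].

Definition grid_size (d K : nat) (Q : nat -> rule)
    (Lam : {set {ffun 'I_d -> 'I_K}}) : nat :=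
  #|` fset_set (grid_points Q Lam)|.

End sparse_grid.

(* Main.v *)
Require Import Defs.
From mathcomp Require Import all_boot all_order all_algebra.
From mathcomp Require Import all_classical all_reals all_analysis.
From mathcomp Require Import measurable_realfun ring lra.

(** Up to a constant the right-hand side is at most [M ^ (- a L / 2)]: the grid of level
    [L] has at least a multiple of [M ^ L * L ^ (d - 1)] points
    ([grid_size_growth]), so [(ln N) ^ (d - 1) / N] is at most a multiple of
    [M ^ (- L)] ([log_rate]).  Hence it suffices to find a function [f] that the
    quadrature integrates to 0, whose Gaussian integral is bounded below, and
    whose Sobolev norm is at most a multiple of [M ^ (a L / 2)].

    A function [f x = g (x_1)] of one coordinate is enough.  Every rule
    integrates constants exactly, so [Delta_l] annihilates them for [l > 1];
    only the levels [(k, 1, ..., 1)] survive, and their contributions telescope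
    to the univariate rule of level [L - d + 1] applied to [g]
    ([sparse_quad_fst]).  That rule has [n <= M0 * M ^ L] nodes.

    It remains to find a smooth [g >= 0] that vanishes at the zeros of the
    Hermite polynomial of degree [n], has Gaussian integral bounded below, and
    has derivatives of order at most [a] of size [O (n ^ (a / 2))]
    ([univariate_fooling]).  This rests on the gaps between these zeros: by the Hermite differential equation a zero
    [x] satisfies [\sum_(y != x) (x - y) ^ (- 2) = (n - 1) / 3 - x ^ 2 / 12]
    ([hermite_root_sum]), so two zeros are at distance at least [n ^ (- 1 / 2)].
    Cut [0, 1] into [m] cells with [m] of the order of [sqrt n] and [m ^ 2 >= n]:
    each cell has a half free of zeros, and [g] is the sum of one bump in each of
    these halves.

    The Sobolev norm of [f] is computed from weak derivatives that are chosen
    arbitrarily, so bounding it takes two facts.  Classical derivatives are weak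
    derivatives, since the integral of a partial derivative of a compactly
    supported function is 0 ([integral_derive_eq0]).  And two weak derivatives
    agree almost everywhere ([weak_deriv_ae_unique]): they have the same integral
    against products of bumps, hence over boxes, hence over all bounded
    measurable sets. *)

Set Implicit Arguments.
Unset Strict Implicit.
Unset Printing Implicit Defensive.
Import Order.TTheory GRing.Theory Num.Theory.
Import numFieldNormedType.Exports.

Local Open Scope classical_set_scope.
Local Open Scope ring_scope.

(** * Gaps between the zeros of a Hermite polynomial *)

Section hermite_gap.
Context {R : realType}.
Local Notation He := (@hermite R).

Lemma hermiteSS n : He n.+2 = 'X * He n.+1 - n.+1%:R%:P * He n.
Proof. by rewrite mul_polyC. Qed.

Lemma deriv_hermite n : (He n.+1)^`() = n.+1%:R%:P * He n.
Proof.
elim/ltn_ind: n => -[|[|n]] IH.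
- by rewrite /= derivX mul1r.
- rewrite hermiteSS derivB !derivM derivX !derivC /=.
  rewrite ?derivX -?(polyC1 R) ?derivC !polyC_natr.
  ring.
rewrite hermiteSS derivB !derivM derivX derivC IH// IH// [in RHS]hermiteSS.
rewrite [He n.+2]hermiteSS !polyC_natr.
ring.
Qed.

Lemma hermite_ode n : (He n)^`()^`() = 'X * (He n)^`() - n%:R%:P * He n.
Proof.
case: n => [|[|n]].
- by rewrite /= -(polyC1 R) !derivC mulr0 mul0r subrr.
- rewrite /= derivX -(polyC1 R) derivC !mulr1 polyC1 mul1r subrr//.
rewrite !deriv_hermite derivM derivC !deriv_hermite [He n.+2]hermiteSS !polyC_natr.
ring.
Qed.

Lemma size_hermite n : size (He n) = n.+1 /\ He n \is monic.
Proof.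
elim/ltn_ind: n => -[|[|n]] IH.
- by rewrite /= size_polyC oner_neq0 monic1.
- by rewrite /= size_polyX monicX.
have [s1 m1] := IH n.+1 (ltnSn _); have [s0 m0] := IH n (ltnW (ltnSn _)).
have sX : size ('X * He n.+1) = n.+3 by rewrite mulrC size_mulX ?monic_neq0// s1.
have lt : (size (- (n.+1%:R%:P * He n)) < size ('X * He n.+1)%R)%N.
  rewrite size_polyN sX mul_polyC (leq_ltn_trans (size_scale_leq _ _))// s0.
  by rewrite ltnS ltnW.
rewrite hermiteSS; split; first by rewrite size_polyDl.
by rewrite monicE lead_coefDl// lead_coefM lead_coefX mul1r -monicE.
Qed.

(** Logarithmic differentiation: [p' / p] is [S1] near [x], with derivative [- S2]. *)
Lemma prod_XsubC_derivs (s : seq R) x : x \notin s ->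
  let p := \prod_(y <- s) ('X - y%:P) in
  let S1 := \sum_(y <- s) (x - y)^-1 in
  let S2 := \sum_(y <- s) ((x - y)^-1 ^+ 2) in
  p^`().[x] = p.[x] * S1 /\ p^`()^`().[x] = p.[x] * (S1 ^+ 2 - S2).
Proof.
elim: s => [|y s IH] /=.
  by rewrite !big_nil -(polyC1 R) derivC deriv0 !horner0; split; ring.
rewrite inE negb_or => /andP[xy xs]; have [e1 e2] := IH xs.
rewrite !big_cons; move: e1 e2.
set p := \prod_(_ <- _) _; set S1 := \sum_(_ <- _) _; set S2 := \sum_(_ <- _) _.
move=> e1 e2; have d0 : x - y != 0 by rewrite subr_eq0.
have -> : (('X - y%:P) * p)^`() = p + ('X - y%:P) * p^`().
  by rewrite derivM derivB derivX derivC subr0 mul1r.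
have -> : (p + ('X - y%:P) * p^`())^`() = p^`() *+ 2 + ('X - y%:P) * p^`()^`().
  by rewrite derivD derivM derivB derivX derivC subr0 mul1r addrA mulr2n.
rewrite !(hornerD, hornerMn, hornerM, hornerN, hornerX, hornerC) e1 e2.
by split; field.
Qed.

(** Write the Hermite polynomial as [('X - x%:P) * q].  Its first three
    derivatives at [x] are [q], [2 q'] and [3 q''], which logarithmic
    differentiation expresses by the sums [S1] and [S2] over the other zeros.
    The Hermite equation at [x] then says [S1 = x / 2], and its derivative
    gives [S2]. *)
Lemma hermite_root_sum n (s : seq R) x : uniq s -> size s = n ->
  (forall y, (y \in s) = root (He n) y) -> x \in s ->
  \sum_(y <- rem x s) (x - y)^-1 ^+ 2 = (n%:R - 1) / 3 - x ^+ 2 / 12.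
Proof.
move=> us ss sE xs; have [sz mo] := size_hermite n.
pose q := \prod_(y <- rem x s) ('X - y%:P).
have pE : He n = ('X - x%:P) * q.
  rewrite /q -(@big_rem _ _ _ _ _ _ xpredT (fun y => 'X - y%:P) xs).
  have : \prod_(y <- s) ('X - y%:P) %| He n.
    apply: uniq_roots_dvdp; last by rewrite uniq_rootsE.
    by apply/allP => y; rewrite sE.
  move/dvdp_size_eqp; rewrite sz size_prod_XsubC ss eqxx.
  by rewrite eqp_monic ?monic_prod_XsubC// => /esym/eqP.
have xr : x \notin rem x s by rewrite mem_rem_uniq// inE eqxx.
have [] := prod_XsubC_derivs xr; rewrite -/q.
set S1 := \sum_(_ <- _) _; set S2 := \sum_(_ <- _) _ => e1 e2.
have q0 : q.[x] != 0.
  by rewrite /q -rootE root_prod_XsubC.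
have He1 : (He n)^`() = q + ('X - x%:P) * q^`().
  by rewrite pE derivM derivB derivX derivC subr0 mul1r.
have He2 : (He n)^`()^`() = q^`() *+ 2 + ('X - x%:P) * q^`()^`().
  by rewrite He1 derivD derivM derivB derivX derivC subr0 mul1r addrA mulr2n.
have He3 : (He n)^`()^`()^`() = q^`()^`() *+ 3 + ('X - x%:P) * q^`()^`()^`().
  by rewrite He2 derivD derivM derivB derivX derivC subr0 mul1r derivMn; ring.
have o1 := congr1 (horner^~ x) (hermite_ode n).
have o2 := congr1 (fun p => horner p^`() x) (hermite_ode n).
rewrite /= derivB !derivM derivX derivC mul1r mul0r add0r in o2.
rewrite /= in o1.
move: o1 o2; rewrite He3 He2 He1 pE.
rewrite !(hornerD, hornerMn, hornerM, hornerN, hornerX, hornerC) subrr e1 e2.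
set c := q.[x] in q0 *; set t := (q^`()^`()^`()).[x].
move=> o1 o2.
have hS1 : S1 = x / 2.
  apply: (mulfI q0); apply: (mulfI (_ : 2 != 0 :> R)); first by rewrite pnatr_eq0.
  by lra.
apply: (mulfI q0); move: o2; rewrite hS1 => o2.
lra.
Qed.

(** All terms of the sum in [hermite_root_sum] are nonnegative, so none of them
    exceeds [n / 3]. *)
Lemma hermite_node_gap n (s : seq R) x y : uniq s -> size s = n ->
  (forall z, (z \in s) = root (He n) z) -> x \in s -> y \in s -> x != y ->
  1 <= n%:R * (x - y) ^+ 2.
Proof.
move=> us ss sE xs ys xy.
have := hermite_root_sum us ss sE xs.
rewrite (big_rem y)/=; last by rewrite mem_rem_uniq// inE ys eq_sym xy.
set T := \sum_(_ <- _) _.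
have T0 : 0 <= T by apply: sumr_ge0 => i _; rewrite exprn_even_ge0.
have d0 : 0 < (x - y) ^+ 2 by rewrite exprn_even_gt0//= subr_eq0.
rewrite exprVn => e.
rewrite -(ler_pM2l (_ : 0 < ((x - y) ^+ 2)^-1)) ?invr_gt0// mulr1 mulrCA mulVf ?gt_eqF// mulr1.
have x20 : 0 <= x ^+ 2 by rewrite exprn_even_ge0.
have : 0 <= n%:R :> R by [].
lra.
Qed.
End hermite_gap.

(** * Smooth functions and bumps on the line *)

Section smooth_univariate.
Context {R : realType}.
Implicit Types f g : R -> R.

(** The derivative is quantified existentially, so that a closure property only
    has to exhibit one. *)
Fixpoint Cn (n : nat) f : Prop :=
  if n is m.+1 then
    exists2 f', (forall x : R, is_derive x 1 f (f' x)) & Cn m f'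
  else True.

Definition Coo f := forall n, Cn n f.

Lemma CnW n f : Cn n.+1 f -> Cn n f.
Proof. by elim: n f => [//|n IH] f [f' df /IH cf']; exists f'. Qed.

Lemma Cn_cst n (c : R) : Cn n (cst c).
Proof. by elim: n c => [//|n IH] c; exists (cst 0) => // x; exact: is_derive_cst. Qed.

Lemma CnD n f g : Cn n f -> Cn n g -> Cn n (f \+ g).
Proof.
elim: n f g => [//|n IH] f g [f' df cf] [g' dg cg].
by exists (f' \+ g'); [move=> x; exact: is_deriveD|exact: IH].
Qed.

Lemma CnM n f g : Cn n f -> Cn n g -> Cn n (f \* g).
Proof.
elim: n f g => [//|n IH] f g cf cg; have cf1 := CnW cf; have cg1 := CnW cg.
case: cf cg => [f' df cf] [g' dg cg].
exists ((f \* g') \+ (g \* f')); last by apply: CnD; exact: IH.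
by move=> x; exact: is_deriveM.
Qed.

Lemma Cn_affine n f (c b : R) : Cn n f -> Cn n (fun x => f (c * x + b)).
Proof.
elim: n f => [//|n IH] f [f' df cf].
exists ((fun x => f' (c * x + b)) \* cst c); last first.
  by apply: CnM; [exact: IH|exact: Cn_cst].
move=> x; have := df (c * x + b).
have da : is_derive x 1 (fun x : R => c * x + b) c.
  have := is_deriveD (is_deriveZ c (is_derive_id x (1 : R))) (is_derive_cst b x 1).
  by rewrite addr0 /GRing.scale/= mulr1.
by move=> h; exact: (@is_derive1_comp _ f (fun x => c * x + b) x _ _ h da).
Qed.

Lemma Coo_derive f : Coo f -> (forall x : R, derivable f x 1) /\ Coo (derive1 f).
Proof.
move=> cf; split=> [x|n]; first by have [f' df _] := cf 1.
have [f' df cf'] := cf n.+1; rewrite (_ : derive1 f = f')//.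
by apply/funext => x; rewrite derive1E; exact: derive_val.
Qed.

Lemma Coo_derive1n f n : Coo f -> Coo (derive1n n f).
Proof.
by move=> cf; elim: n => [//|n IH]; rewrite derive1nS; exact: (Coo_derive IH).2.
Qed.

Lemma is_derive_derive1n f n (x : R) : Coo f ->
  is_derive x 1 (derive1n n f) (derive1n n.+1 f x).
Proof.
move=> /(Coo_derive1n n)/Coo_derive[df _].
by rewrite derive1nS derive1E; exact: derivableP.
Qed.

Lemma continuous_derive1n f n : Coo f -> continuous (derive1n n f).
Proof.
move=> cf x; apply/differentiable_continuous/derivable1_diffP.
by have [] := is_derive_derive1n n x cf.
Qed.

(** [y ^+ i <= i ^+ i * expR y], because [y / i <= expR (y / i)]. *)
Lemma horner_expR_bound (p : {poly R}) :
  exists2 C : R, 0 <= C & forall y, 0 <= y -> `|p.[y]| <= C * expR y.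
Proof.
exists (\sum_(i < size p) `|p`_i| * i%:R ^+ i) => [|y y0].
  by apply: sumr_ge0 => i _; rewrite mulr_ge0// exprn_ge0.
rewrite horner_coef (le_trans (ler_norm_sum _ _ _))// mulr_suml.
apply: ler_sum => -[i _] _ /=; rewrite normrM -mulrA ler_wpM2l// ger0_norm ?exprn_ge0//.
case: i => [|i]; first by rewrite !expr0 mul1r -[X in X <= _]expR0 ler_expR.
have i0 : 0 < i.+1%:R :> R by [].
rewrite -[X in X ^+ _ <= _](divfK (lt0r_neq0 i0)) mulrC exprMn ler_wpM2l ?exprn_ge0//.
rewrite -[X in _ <= expR X](divfK (lt0r_neq0 i0)) expRM_natr
  ler_pXn2r ?nnegrE ?expR_ge0 ?divr_ge0//.
by rewrite (le_trans _ (expR_ge1Dx _))// lerDr.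
Qed.

(** Contains [exp (- 1 / x)], extended by 0 to the nonpositive reals, and is
    closed under derivation: each derivative of such a function is again of the
    form [p (1 / x) * exp (- 1 / x)]. *)
Definition flat (p : {poly R}) (x : R) : R :=
  if 0 < x then p.[x^-1] * expR (- x^-1) else 0.

(** The quadratic bound makes [flat p] differentiable at 0, with derivative 0. *)
Lemma flat_sqr_bound (p : {poly R}) :
  exists2 C, 0 <= C & forall x, `|flat p x| <= C * x ^+ 2.
Proof.
have [C C0 hC] := horner_expR_bound ('X^2 * p); exists C => // x.
rewrite /flat; case: ifPn => [x0|_]; last by rewrite normr0 mulr_ge0 ?sqr_ge0.
have i0 : 0 < x^-1 by rewrite invr_gt0.
have := hC _ (ltW i0); rewrite hornerM hornerXn normrM => h.
rewrite normrM (ger0_norm (expR_ge0 _)) expRN ler_pdivrMr ?expR_gt0//.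
rewrite ger0_norm ?sqr_ge0// exprVn ler_pdivrMl ?exprn_gt0// in h.
by rewrite mulrAC mulrC.
Qed.

Lemma is_derive_flat (p : {poly R}) (x : R) :
  is_derive x 1 (flat p) (flat ('X^2 * (p - p^`())) x).
Proof.
have [x0|x0|->] := ltgtP x 0.
- rewrite {2}/flat ltNge (ltW x0)/=.
  apply: (@near_eq_is_derive _ _ _ (cst 0)).
  near=> y; rewrite /flat ltNge (_ : y <= 0)//.
  by near: y; exact: lt_le_nbhsl.
- rewrite {2}/flat x0. 
  apply: (@near_eq_is_derive R R R (fun y : R => p.[y^-1] * expR (- y^-1))).
    near=> y; rewrite /flat (_ : 0 < y)//.
    by near: y; exact: lt_nbhsr.
  have dV : is_derive x 1 (fun y : R => y^-1) (- x ^- 2).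
    apply: is_derive_eq; first by apply: (@is_deriveV _ id); rewrite gt_eqF.
    by rewrite /GRing.scale/= mulr1.
  have dp := is_derive1_comp (is_derive_poly p x^-1) dV.
  have dN : is_derive x 1 (fun y : R => - y^-1) (- - x ^- 2) by exact: is_deriveN.
  have de := @is_derive1_comp _ expR (fun y : R => - y^-1) x _ _ (is_derive_expR (- x^-1)) dN.
  apply: (@is_derive_eq _ _ _ _ _ _ _ _ (is_deriveM dp de)).
  rewrite /GRing.scale/= hornerM hornerXn hornerD hornerN -exprVn; ring.
- have lim0 : h^-1 *: (flat p (h *: 1 + 0) - flat p 0) @[h --> 0^'] --> (0 : R).
    have [C C0 hC] := flat_sqr_bound p.
    have f0 : flat p 0 = 0 by rewrite /flat ltxx.
    apply/cvgr0Pnorm_le => /= e e0.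
    have C1 : 0 < C + 1 by rewrite ltr_wpDl.
    have eC : 0 < e / (C + 1) by rewrite divr_gt0.
    near=> h.
    have h0 : h != 0 by near: h; exact: nbhs_dnbhs_neq.
    rewrite f0 subr0 addr0 normrZ normfV ler_pdivrMl ?normr_gt0//.
    rewrite [h *: 1]mulr1 (le_trans (hC _))//.
    rewrite -real_normK ?num_real// expr2 mulrCA ler_wpM2l//.
    have : `|h| < e / (C + 1) by near: h; exact: dnbhs0_lt.
    rewrite ltr_pdivlMr// => he.
    by rewrite (le_trans _ (ltW he))// mulrC ler_wpM2l// lerDl.
  rewrite {2}/flat ltxx; apply: DeriveDef; first by apply/cvg_ex; exists 0.
  exact: cvg_lim lim0.
Unshelve. all: by end_near.
Qed.

Lemma Coo_flat p : Coo (flat p).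
Proof.
move=> n; elim: n p => [//|n IH] p.
by exists (flat ('X^2 * (p - p^`()))) => // x; exact: is_derive_flat.
Qed.

Definition expinv : R -> R := flat 1.

Lemma Coo_expinv : Coo expinv. Proof. exact: Coo_flat. Qed.

Lemma expinvE x : expinv x = if 0 < x then expR (- x^-1) else 0.
Proof. by rewrite /expinv /flat hornerC mul1r. Qed.

Lemma expinv_ge0 x : 0 <= expinv x.
Proof. by rewrite expinvE; case: ifP => // _; exact: expR_ge0. Qed.

Lemma expinv_le1 x : expinv x <= 1.
Proof.
rewrite expinvE; case: ifP => // x0.
by rewrite expR_le1 oppr_le0 invr_ge0 ltW.
Qed.

(** Scaling the argument by [k] takes a [k]-th root,
    [expinv (k * t) = expinv t ^ (1 / k)], so these functions converge to the
    indicator of the interval when [k] grows. *)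
Definition bump (k : nat) (a b x : R) : R :=
  expinv (k%:R * (x - a)) * expinv (k%:R * (b - x)).

Lemma Coo_bump k a b : Coo (bump k a b).
Proof.
move=> n; rewrite (_ : bump _ _ _ = (fun x => expinv (k%:R * x + (- (k%:R * a)))) \*
   (fun x => expinv (- k%:R * x + k%:R * b))).
  by apply: CnM; apply: Cn_affine; exact: Coo_expinv.
by apply/funext => x; rewrite /bump/=; congr (expinv _ * expinv _); ring.
Qed.

Lemma bump_ge0 k a b x : 0 <= bump k a b x.
Proof. by rewrite mulr_ge0// expinv_ge0. Qed.

Lemma bump_le1 k a b x : bump k a b x <= 1.
Proof. by rewrite mulr_ile1 ?expinv_ge0 ?expinv_le1. Qed.

Lemma bump_out k a b x : ~~ (a < x < b) -> bump k a b x = 0.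
Proof.
rewrite negb_and -!leNgt /bump !expinvE => /orP[xa|bx].
  by rewrite ltNge mulr_ge0_le0 ?subr_le0//= mul0r.
by rewrite [X in _ * X](_ : _ = 0) ?mulr0// ltNge mulr_ge0_le0 ?subr_le0.
Qed.

Lemma bump_cvg a b x :
  bump k a b x @[k --> \oo] --> (\1_(`]a, b[%classic) x : R).
Proof.
have inv0 (t : R) : 0 < t -> expinv (k%:R * t) @[k --> \oo] --> (1 : R).
  move=> t0; rewrite -cvg_shiftS/=.
  rewrite (_ : (fun _ => _) = (fun k => expR (- (t^-1 * harmonic k)))); last first.
    apply/funext => k; rewrite expinvE mulr_gt0//; congr expR.
    by rewrite /harmonic/= invfM mulrC.
  have h : - (t^-1 * harmonic k) @[k --> \oo] --> (0 : R).
    rewrite -[X in _ --> X]oppr0 -[X in _ --> - X](mulr0 t^-1).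
    by apply: cvgN; apply: cvgM; [exact: cvg_cst|exact: cvg_harmonic].
  by have := cvg_comp _ _ h (@continuous_expR R 0); rewrite expR0.
rewrite indicE; case: (boolP (a < x < b)) => [abx|abx].
  rewrite mem_set/= ?in_itv//= -[X in _ --> X]mulr1.
  by case/andP: abx => ax xb; apply: cvgM; apply: inv0; rewrite subr_gt0.
rewrite memNset/= ?in_itv//=; last exact/negP.
by rewrite (_ : (fun _ => _) = cst 0); [exact: cvg_cst|apply/funext => k; exact: bump_out].
Qed.

Lemma bump_mid (x : R) : 4^-1 <= x <= 3 / 4 -> expR (- 8) <= bump 1 0 1 x.
Proof.
move=> /andP[x1 x2]; have x0 : 0 < x by lra.
have y0 : 0 < 1 - x by lra.
rewrite /bump !mul1r subr0 !expinvE x0 y0 -expRD ler_expR.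
have h1 : x^-1 <= 4 by rewrite -[4]invrK lef_pV2// posrE.
have h2 : (1 - x)^-1 <= 4.
  by rewrite -[4]invrK lef_pV2// ?posrE//; lra.
lra.
Qed.

(** One side of [x] avoids the open interval, also when [x] is an endpoint, and
    the difference quotients on that side are 0. *)
Lemma derive1_out f (a b : R) x : (forall y, ~~ (a < y < b) -> f y = 0) ->
  derivable f x 1 -> ~~ (a < x < b) -> derive1 f x = 0.
Proof.
move=> f0 /cvg_ex[/= l fl] xab; rewrite derive1E /derive.
have -> : lim (h^-1 *: ((f \o shift x) (h *: 1) - f x) @[h --> 0^']) = l by exact: cvg_lim fl.
have fx := f0 _ xab; move: xab; rewrite negb_and -!leNgt => /orP[xa|bx].
  apply/esym; apply: (cvg_unique _ _ (cvg_dnbhs_at_left fl)) => //.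
  apply: (@cvg_near_cst _ _ _ _ _ _) => //; near=> h.
  rewrite /= fx f0 ?subr0 ?scaler0// [h *: 1]mulr1 negb_and -!leNgt.
  have h0 : h < 0 by near: h; exact: nbhs_left_lt.
  by apply/orP; left; rewrite (le_trans _ xa)// gerDr ltW.
apply/esym; apply: (cvg_unique _ _ (cvg_dnbhs_at_right fl)) => //.
apply: (@cvg_near_cst _ _ _ _ _ _) => //; near=> h.
rewrite /= fx f0 ?subr0 ?scaler0// [h *: 1]mulr1 negb_and -!leNgt.
have h0 : 0 < h by near: h; exact: nbhs_right_gt.
by apply/orP; right; rewrite (le_trans bx)// lerDr ltW.
Unshelve. all: by end_near. Qed.

Lemma derive1n_out f (a b : R) n x : (forall y, ~~ (a < y < b) -> f y = 0) ->
  Coo f -> ~~ (a < x < b) -> derive1n n f x = 0.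
Proof.
move=> f0 cf; elim: n x => [|n IH] x xab; first exact: f0.
rewrite derive1nS; apply: (derive1_out IH) => //.
by have [] := is_derive_derive1n n x cf.
Qed.

Lemma derive1n_bounded f (a b : R) n : (forall y, ~~ (a < y < b) -> f y = 0) ->
  Coo f -> exists2 C, 0 <= C & forall x, `|derive1n n f x| <= C.
Proof.
move=> f0 cf; have [ab|ba] := leP a b; last first.
  exists 0 => // x; rewrite (derive1n_out n f0 cf) ?normr0//.
  by apply/negP => /andP[ax xb]; have := lt_trans ba (lt_trans ax xb); rewrite ltxx.
have cn : {within `[a, b], continuous (fun x => `|derive1n n f x|)}.
  apply: continuous_subspaceT => x.
  by apply: continuous_comp; [exact: continuous_derive1n|exact: norm_continuous].
have [c _ hc] := EVT_max ab cn; exists (`|derive1n n f c|) => // x.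
have [xab|xab] := boolP (a < x < b); last by rewrite (derive1n_out n f0 cf) ?normr0.
by apply: hc; rewrite in_itv/=; case/andP: xab => /ltW-> /ltW->.
Qed.
End smooth_univariate.

(** * Lebesgue integration and continuity on rows *)

Section lebesgue_row_integration.
Context {R : realType}.
Local Notation RT := (measurableTypeR R).
Local Notation leb := (@lebesgue_row R).

Lemma ge0_integral_lebesgue_rowS n (F : 'rV[RT]_n.+1 -> \bar R) :
  measurable_fun setT F -> (forall x, (0 <= F x)%E) ->
  (\int[leb n.+1]_z F z =
   \int[@lebesgue_measure R]_x \int[leb n]_y F (row_cons (x, y)))%E.
Proof.
move=> mF F0; have mc := @measurable_row_cons R n.
rewrite -(fubini_tonelli1 (F \o @row_cons R n) (measurableT_comp mF mc) (fun x => F0 _)).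
have := ge0_integral_pushforward mc (@lebesgue_measure R \x leb n)%E
  measurableT mF (fun y _ => F0 y).
by rewrite preimage_setT.
Qed.

Lemma integrable_lebesgue_rowS n (F : 'rV[RT]_n.+1 -> \bar R) :
  (leb n.+1).-integrable setT F ->
  (@lebesgue_measure R \x leb n)%E.-integrable setT (F \o @row_cons R n).
Proof.
move=> /integrableP[mF iF]; have mFc : measurable_fun setT (F \o @row_cons R n).
  by apply: measurableT_comp => //; exact: measurable_row_cons.
apply/integrable12ltyP => //.
by rewrite ge0_integral_lebesgue_rowS// in iF; exact: measurableT_comp.
Qed.

Lemma integral_lebesgue_rowS n (F : 'rV[RT]_n.+1 -> \bar R) :
  (leb n.+1).-integrable setT F ->
  (\int[leb n.+1]_z F z =
   \int[@lebesgue_measure R]_x \int[leb n]_y F (row_cons (x, y)))%E.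
Proof.
move=> iF; have mF := measurable_int _ iF; have iFc := integrable_lebesgue_rowS iF.
rewrite [RHS](integral12_prod_meas1 iFc).
by have := integral_pushforward (@measurable_row_cons R n) mF iFc measurableT;
  rewrite preimage_setT.
Qed.

Lemma integral_lebesgue_rowS_swap n (F : 'rV[RT]_n.+1 -> \bar R) :
  (leb n.+1).-integrable setT F ->
  (\int[leb n.+1]_z F z =
   \int[leb n]_y \int[@lebesgue_measure R]_x F (row_cons (x, y)))%E.
Proof.
move=> iF; rewrite integral_lebesgue_rowS//.
by rewrite (Fubini (integrable_lebesgue_rowS iF)).
Qed.

Definition cube n (B : R) : set 'rV[RT]_n := [set x | forall i, `|x ord0 i| <= B].

Arguments cube n B : clear implicits.

Lemma measurable_coord_set n (A : 'I_n -> set RT) :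
  (forall i, measurable (A i)) ->
  measurable [set x : 'rV[RT]_n | forall i, A i (x ord0 i)].
Proof.
move=> mA; rewrite (_ : [set _ | _] = \bigcap_(i in [set: 'I_n]) (row_coord i @^-1` A i)).
  apply: fin_bigcap_measurable => [|i _]; first exact: finite_finset.
  by rewrite -[X in measurable X]setTI; exact: measurable_row_coord.
by apply/seteqP; split => x /= h i; [move=> _|]; exact: h.
Qed.

Lemma measurable_cube n B : measurable (cube n B).
Proof.
apply: (@measurable_coord_set n (fun=> [set t | `|t| <= B])) => i.
rewrite (_ : [set _ | _] = `[- B, B]%classic)//.
by apply/seteqP; split => t /=; rewrite in_itv/= ler_norml.
Qed.

Lemma lebesgue_cube n B : (leb n (cube n B) < +oo)%E.
Proof.
elim: n => [|n IH]; first by rewrite /= diracE; case: (_ \in _); rewrite ltry.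
rewrite [X in (X < _)%E](_ : _ = (@lebesgue_measure R \x leb n)%E
  ([set t | `|t| <= B] `*` cube n B)); last first.
  rewrite /= /lebesgue_row_step /pushforward; congr (_ _).
  apply/seteqP; split => [[t y] /= h|[t y] [/= tB yB] i].
    split => [|i]; first by have := h ord0; rewrite row_cons0.
    by have := h (lift ord0 i); rewrite row_consS.
  by case: (fintype.unliftP ord0 i) => [j ->|->]; rewrite ?row_consS ?row_cons0.
have e : [set t : R | `|t| <= B] = `[- B, B]%classic.
  by apply/seteqP; split => t /=; rewrite in_itv/= ler_norml.
rewrite product_measure1E//; [|by rewrite e|exact: measurable_cube].
have fB : (@lebesgue_measure R `[(- B)%R, B]%classic < +oo)%E.
  by rewrite lebesgue_measure_itv/=; case: ifP => _; rewrite ?ltry// -EFinB ltry.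
by rewrite lte_mul_pinfty// e ge0_fin_numE.
Qed.

Lemma row_rat_approx n (x : 'rV[R]_n) (e : R) : 0 < e ->
  exists q : 'rV[rat]_n, forall i, `|ratr (q ord0 i) - x ord0 i| < e.
Proof.
move=> e0; have h (i : 'I_n) : exists q : rat, `|ratr q - x ord0 i| < e.
  have xe : x ord0 i < x ord0 i + e by rewrite ltrDl.
  have [q] := rat_in_itvoo xe; rewrite in_itv/= => /andP[q1 q2]; exists q.
  by rewrite ger0_norm ?subr_ge0 ?(ltW q1)// ltrBlDl.
have [q hq] := choice h; exists (\row_i q i) => i; by rewrite mxE.
Qed.

(** An open set is the union of the countably many cubes with rational centre and
    half-width [1 / k] that it contains. *)
Lemma open_measurable_row n (U : set 'rV[R]_n) : open U ->
  measurable (U : set 'rV[RT]_n).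
Proof.
move=> oU.
pose V (p : 'rV[rat]_n * nat) : set 'rV[R]_n :=
  [set y | forall i, `|ratr (p.1 ord0 i) - y ord0 i| < p.2.+1%:R^-1].
rewrite (_ : U = \bigcup_p (if `[< V p `<=` U >] then V p else set0)); last first.
  apply/seteqP; split => [x Ux|x [p _]]; last by case: asboolP => // VU /VU.
  have /nbhs_ballP[e /= e0 eU] : nbhs x U by apply: open_nbhs_nbhs.
  have k0 : 0 < e / 2 by rewrite divr_gt0.
  have [k _ /(_ k (leqnn k)) /= ke] := near_infty_natSinv_lt (PosNum k0).
  have k1 : 0 < (k.+1%:R : R)^-1 by rewrite invr_gt0.
  have [q hq] := row_rat_approx x k1; exists (q, k) => //.
  case: asboolP => // -[] y Vy; apply: eU; split => // i j.
  rewrite (ord1 i) /ball/=.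
  rewrite (_ : _ - _ =
    (x ord0 j - ratr (q ord0 j)) + (ratr (q ord0 j) - y ord0 j)); last by ring.
  have := hq j; have := Vy j; rewrite /= (distrC (ratr (q ord0 j)) (x ord0 j)) => h1 h2.
  rewrite (le_lt_trans (ler_normD _ _))// (lt_trans (ltrD h2 h1))//.
  by rewrite [e]splitr; apply: ltrD.
apply: countable_bigcupT_measurable => [|p]; first exact: countableP.
case: ifP => // _.
apply: (@measurable_coord_set n
  (fun i => [set t | `|ratr (p.1 ord0 i) - t| < p.2.+1%:R^-1])) => i.
apply: open_measurable.
rewrite (_ : [set _ | _] = ball (ratr (p.1 ord0 i) : R) p.2.+1%:R^-1)//.
exact: ball_open.
Qed.

Lemma continuous_measurable_row n (f : 'rV[R]_n -> R) : continuous f ->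
  measurable_fun setT (f : 'rV[RT]_n -> R).
Proof.
move=> cf; apply: (measurability _ (RGenOpens.measurableE R)) => _ [_ [a [b ->] <-]].
rewrite setTI; apply: open_measurable_row.
by move/continuousP: cf; apply; exact: interval_open.
Qed.


Lemma continuous_row (T : topologicalType) n (f : T -> 'rV[R]_n) :
  (forall i, continuous (fun x => f x ord0 i)) -> continuous f.
Proof.
move=> cf x; apply/cvg_ballP => e e0.
have h (i : 'I_n) : \forall y \near x, ball (f x ord0 i) e (f y ord0 i).
  by have /cvg_ballP/(_ e e0) := cf i x.
have hh := @filter_forall _ _ (fun i y => ball (f x ord0 i) e (f y ord0 i))
  (nbhs x) (nbhs_filter x) h.
apply: (@filterS _ (nbhs x) (nbhs_filter x) _ _ _ hh) => y hy.
by split=> // i j; rewrite (ord1 i).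
Qed.

Lemma continuous_row_consl n (y : 'rV[R]_n) :
  continuous (fun x : R => row_cons (x, y) : 'rV[R]_n.+1).
Proof.
apply: continuous_row => i.
case: (fintype.unliftP ord0 i) => [j ->|->].
  by under eq_fun do rewrite row_consS; move=> x; exact: cvg_cst.
by under eq_fun do rewrite row_cons0; move=> x; exact: cvg_id.
Qed.

Lemma continuous_row_consr n (x : R) :
  continuous (fun y : 'rV[R]_n => row_cons (x, y) : 'rV[R]_n.+1).
Proof.
apply: continuous_row => i.
case: (fintype.unliftP ord0 i) => [j ->|->].
  under eq_fun do rewrite row_consS/=.
  exact: coord_continuous.
under eq_fun do rewrite row_cons0/=.
exact: cst_continuous.
Qed.

(** A directional derivative depends only on the values on a line.  This moves
    derivatives between rows of different lengths and down to the real line. *)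
Lemma derive_on_line (V W : normedModType R) (f : V -> R) (g : W -> R) a b v w :
  (forall t : R, f (t *: v + a) = g (t *: w + b)) ->
  (derivable f a v -> derivable g b w) /\ 'D_v f a = 'D_w g b.
Proof.
move=> fg; have e : (fun h : R => h^-1 *: ((f \o shift a) (h *: v) - f a)) =
    (fun h : R => h^-1 *: ((g \o shift b) (h *: w) - g b)).
  apply/funext => h /=; rewrite fg; congr (_ *: (_ - _)).
  by have := fg 0; rewrite !scale0r !add0r.
by rewrite /derivable /derive e.
Qed.

Lemma compact_cube n B : compact (cube n B : set 'rV[R]_n).
Proof.
rewrite (_ : cube n B = [set v : 'rV[R]_n | forall i, `[- B, B]%classic (v ord0 i)]).
  by apply: (@rV_compact R n (fun=> `[- B, B]%classic)) => i; exact: segment_compact.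
by apply/seteqP; split => x h i; have := h i; rewrite /= in_itv/= ler_norml.
Qed.

Lemma compact_bounded_fun n (f : 'rV[R]_n -> R) (K : set 'rV[R]_n) : continuous f ->
  compact K -> exists2 C, 0 <= C & forall x, K x -> `|f x| <= C.
Proof.
move=> cf cK; have cfK : {within K, continuous f} by exact: continuous_subspaceT.
have /compact_bounded[M [Mr hM]] := continuous_compact cfK cK.
exists (`|M| + 1) => [|x Kx]; first by rewrite addr_ge0.
by apply: (hM (`|M| + 1)); [rewrite (le_lt_trans (ler_norm M))// ltrDl|exists x].
Qed.

Lemma compact_sub_cube n (K : set 'rV[R]_n) : compact K -> exists2 B, 0 <= B & K `<=` cube n B.
Proof.
move=> cK; pose c (i : 'I_n) := fun x : 'rV[R]_n => x ord0 i.
have h i : exists B, 0 <= B /\ forall x, K x -> `|c i x| <= B.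
  by have [C C0 hC] := compact_bounded_fun (@coord_continuous _ 1 n ord0 i) cK; exists C.
have [B hB] := choice h; exists (\sum_i B i) => [|x Kx i].
  by apply: sumr_ge0 => i _; have [] := hB i.
have [_ /(_ x Kx) h1] := hB i; rewrite (le_trans h1)//.
rewrite (bigD1 i)//= lerDl; apply: sumr_ge0 => j _; by have [] := hB j.
Qed.

End lebesgue_row_integration.
Arguments cube {R} n B.

(** * The integral of a partial derivative *)

Section integration_by_parts_row.
Context {R : realType}.
Local Notation RT := (measurableTypeR R).
Local Notation leb := (@lebesgue_row R).

Lemma integrable_on n (D : set 'rV[RT]_n) (f : 'rV[RT]_n -> R) :
  measurable D -> (forall x, ~ D x -> f x = 0) ->
  (leb n).-integrable D (EFin \o f) -> (leb n).-integrable setT (EFin \o f).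
Proof.
move=> mD f0 fi; rewrite (_ : EFin \o f = (EFin \o f) \_ D).
  by apply/integrable_restrict => //; rewrite setTI.
apply/funext => x; rewrite patchE; case: ifPn => //.
by move/negP => xD; rewrite /= f0//; apply: contra_not xD; rewrite inE.
Qed.

Lemma integrable_bounded_on n (D : set 'rV[RT]_n) (f : 'rV[RT]_n -> R) C :
  measurable D -> (leb n D < +oo)%E -> measurable_fun D f ->
  (forall x, D x -> `|f x| <= C) -> (leb n).-integrable D (EFin \o f).
Proof.
move=> mD fD mf fC; apply: measurable_bounded_integrable => //.
exists C; split; first exact: num_real.
by move=> y Cy x Dx; apply: le_trans (fC x Dx) _; exact: ltW.
Qed.

Lemma integrable_cube n (f : 'rV[RT]_n -> R) B C :
  measurable_fun setT f -> (forall x, `|f x| <= C) ->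
  (forall x, ~ cube n B x -> f x = 0) ->
  (leb n).-integrable setT (EFin \o f).
Proof.
move=> mf fC f0; have mB := @measurable_cube R n B.
apply: (integrable_on mB f0); apply: (@integrable_bounded_on _ _ _ C) => //.
  exact: lebesgue_cube.
exact: measurable_funTS.
Qed.

Lemma closed_cube n B : closed (cube n B : set 'rV[R]_n).
Proof. by apply: compact_closed; [exact: norm_hausdorff|exact: compact_cube]. Qed.

Lemma derive_out_cube n (h : 'rV[R]_n -> R) B v x :
  (forall x, ~ cube n B x -> h x = 0) -> ~ cube n B x -> 'D_v h x = 0.
Proof.
move=> h0 xB; rewrite (@near_eq_derive _ _ _ h (cst 0)) ?derive_cst//.
have : nbhs x (~` cube n B : set 'rV[R]_n).
  by apply: open_nbhs_nbhs; split => //; apply/closed_openC/closed_cube.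
by apply: filterS => y /h0.
Qed.

Lemma bounded_on_cube n (f : 'rV[R]_n -> R) B : continuous f ->
  (forall x, ~ cube n B x -> f x = 0) -> exists2 C, 0 <= C & forall x, `|f x| <= C.
Proof.
move=> cf f0; have [C C0 hC] := compact_bounded_fun cf (@compact_cube R n B).
exists C => // x; have [xB|xB] := pselect (cube n B x); first exact: hC.
by rewrite f0// normr0.
Qed.

Lemma integral_derive1_eq0 (u : R -> R) B : 
  (forall x, derivable u x 1) -> continuous ('D_1 u) ->
  (forall x, ~ `|x| <= B -> u x = 0) ->
  (\int[@lebesgue_measure R]_x ('D_1 u x)%:E = 0)%E.
Proof.
move=> du cu u0.
(* [B] may be negative; [b] is a positive radius beyond the support. *)
pose b := `|B| + 1; have b0 : 0 < b by rewrite ltr_pwDr.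
have ub x : ~~ (- b < x < b) -> u x = 0.
  move=> h; apply: u0; apply/negP; rewrite -ltNge; move: h.
  rewrite -ltr_norml -leNgt; apply: lt_le_trans.
  by rewrite (le_lt_trans (ler_norm B))// ltrDl.
have dub x : ~~ (- b < x < b) -> 'D_1 u x = 0.
  by move=> h; rewrite -derive1E; exact: (derive1_out ub).
have bb : - b < b by rewrite ltrNl (lt_trans _ b0)// oppr_lt0.
have cuv : continuous u.
  by move=> x; apply/differentiable_continuous/derivable1_diffP.
transitivity (\int[@lebesgue_measure R]_(x in `[(- b)%R, b]) ('D_1 u x)%:E)%E.
  rewrite [RHS]integral_mkcond; apply: eq_integral => x _.
  rewrite patchE mem_setE; case: ifPn => // xb; rewrite dub//.
  by apply: contra xb => /andP[/ltW ? /ltW ?]; rewrite in_itv/=; exact/andP.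
rewrite (@continuous_FTC2 _ _ u)//.
- by rewrite !ub ?subee// ?ltxx ?andbF.
- exact: continuous_subspaceT.
- by split => //; [exact/cvg_at_right_filter/cuv|exact/cvg_at_left_filter/cuv].
- by move=> x _; rewrite derive1E.
Qed.

Lemma unit_row_lineE n (i k : 'I_n) (t : R) (x : 'rV[R]_n) :
  (t *: unit_row i + x) ord0 k = t * (k == i)%:R + x ord0 k.
Proof. by rewrite mxE [X in X + _]mxE [unit_row i _ _]mxE eqxx. Qed.

(** By Fubini one may integrate first over the coordinate 0 or first over the
    others: the inner integral vanishes by the univariate case if [i] is 0, and
    by induction otherwise. *)
Lemma integral_derive_eq0 n (i : 'I_n) (h : 'rV[R]_n -> R) B :
  (forall x, derivable h x (unit_row i)) -> continuous ('D_(unit_row i) h) ->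
  (forall x, ~ cube n B x -> h x = 0) ->
  (\int[leb n]_x ('D_(unit_row i) h x)%:E = 0)%E.
Proof.
elim: n i h => [[]//|n IH] i h dh cdh h0.
have h0' x : ~ cube n.+1 B x -> 'D_(unit_row i) h x = 0 by exact: derive_out_cube.
have [C C0 hC] := bounded_on_cube cdh h0'.
have ih : (leb n.+1).-integrable setT (EFin \o 'D_(unit_row i) h).
  by apply: (integrable_cube _ hC h0'); exact: continuous_measurable_row.
case: (fintype.unliftP ord0 i) => [j|] ie; rewrite {i}ie in dh cdh h0' hC ih *.
  rewrite integral_lebesgue_rowS// integral0_eq// => x _.
  have lineE y (t : R) : h (t *: unit_row (lift ord0 j) + row_cons (x, y)) =
      h (row_cons (x, t *: unit_row j + y)).
    congr h; apply/rowP => k; rewrite unit_row_lineE.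
    case: (fintype.unliftP ord0 k) => [l ->|->]; rewrite ?row_consS ?row_cons0/=.
      by rewrite unit_row_lineE (inj_eq lift_inj).
    by rewrite mulr0 add0r.
  have e y := @derive_on_line _ 'rV[R]_n.+1 'rV[R]_n h (fun y => h (row_cons (x, y)))
    _ _ _ _ (lineE y).
  rewrite -[RHS](IH j (fun y => h (row_cons (x, y)))).
  - by apply: eq_integral => y _; rewrite (e y).2.
  - by move=> y; apply: (e y).1.
  - rewrite (_ : 'D_(unit_row j) _ =
        (fun y => 'D_(unit_row (lift ord0 j)) h (row_cons (x, y)))).
      by move=> y; apply: (@continuous_comp _ _ _ (fun y => row_cons (x, y))
        ('D_(unit_row (lift ord0 j)) h));
        [exact: continuous_row_consr|exact: cdh].
    by apply/funext => y; rewrite (e y).2.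
  - move=> y yB; apply: h0; apply: contra_not yB => xyB k.
    by have := xyB (lift ord0 k); rewrite row_consS.
rewrite integral_lebesgue_rowS_swap// integral0_eq// => y _.
have lineE x (t : R) : h (t *: unit_row ord0 + row_cons (x, y)) =
    h (row_cons (t *: (1 : R) + x, y)).
  congr h; apply/rowP => k; rewrite unit_row_lineE.
  case: (fintype.unliftP ord0 k) => [l ->|->]; rewrite ?row_consS ?row_cons0/=.
    by rewrite mulr0 add0r.
  by [].
have e x := @derive_on_line _ 'rV[R]_n.+1 R h (fun x => h (row_cons (x, y)))
    _ _ _ _ (lineE x).
rewrite -[RHS](@integral_derive1_eq0 (fun x => h (row_cons (x, y))) B).
-
  by apply: eq_integral => x _; rewrite (e x).2.
- by move=> x; apply: (e x).1.
- rewrite (_ : (fun x : R => derive (fun x : R => h (row_cons (x, y))) x 1) =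
      (fun x : R => 'D_(unit_row ord0) h (row_cons (x, y)))).
    by move=> x; apply: (@continuous_comp _ _ _ (fun x => row_cons (x, y))
      ('D_(unit_row ord0) h));
      [exact: continuous_row_consl|exact: cdh].
  by apply/funext => x; rewrite (e x).2.
- move=> x xB; apply: h0; apply: contra_not xB => xyB.
  by have := xyB ord0; rewrite row_cons0.
Qed.

End integration_by_parts_row.

(** * Uniqueness of weak derivatives *)

Section weak_derivative_unique.
Context {R : realType} {n : nat}.
Local Notation RT := (measurableTypeR R).
Local Notation leb := (@lebesgue_row R n).

Lemma continuous_prod_coord (E : 'I_n -> R -> R) : (forall i, continuous (E i)) ->
  continuous (fun x : 'rV[R]_n => \prod_i E i (x ord0 i)).
Proof.
move=> cE; elim: (index_enum _) => [|i r IH].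
  by under eq_fun do rewrite big_nil; move=> x; exact: cst_continuous.
under eq_fun do rewrite big_cons; move=> x; apply: continuousM; last exact: IH.
apply: (@continuous_comp _ _ _ (fun x : 'rV[R]_n => x ord0 i) (E i)); last exact: cE.
exact: coord_continuous.
Qed.

Lemma derive_prod_coord (E : 'I_n -> R -> R) i (x : 'rV[R]_n) :
  derivable (E i) (x ord0 i) 1 ->
  derivable (fun x : 'rV[R]_n => \prod_j E j (x ord0 j)) x (unit_row i) /\
  'D_(unit_row i) (fun x : 'rV[R]_n => \prod_j E j (x ord0 j)) x =
  derive1 (E i) (x ord0 i) * \prod_(j | j != i) E j (x ord0 j).
Proof.
move=> dE; set C := \prod_(j | _) _.
have lineE (t : R) : E i (t *: (1 : R) + x ord0 i) * C =
    \prod_j E j ((t *: unit_row i + x) ord0 j).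
  rewrite [RHS](bigD1 i)//= unit_row_lineE eqxx; congr (_ * _).
  by apply: eq_bigr => j ji; rewrite unit_row_lineE (negbTE ji) mulr0 add0r.
have [h <-] := @derive_on_line _ R 'rV[R]_n (fun y => E i y * C)
  (fun x => \prod_j E j (x ord0 j)) _ _ _ _ lineE.
have dC : is_derive (x ord0 i) 1 (fun y => E i y * C) (derive1 (E i) (x ord0 i) * C).
  rewrite derive1E; have := is_deriveM (derivableP dE) (is_derive_cst C (x ord0 i) (1 : R)).
  by rewrite scaler0 add0r [C *: _]mulrC.
by split; [apply: h; exact: ex_derive|exact: derive_val].
Qed.

(** A partial derivative acts on a single factor of the product. *)
Lemma iter_partial_prod_coord (E : 'I_n -> R -> R) s : (forall i, Coo (E i)) ->
  iter_partial s (fun x : 'rV[R]_n => \prod_j E j (x ord0 j)) =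
  (fun x : 'rV[R]_n => \prod_j derive1n (count_mem j s) (E j) (x ord0 j)).
Proof.
move=> cE; elim: s => [|i s IH] //=; rewrite IH; apply/funext => x.
have [//|_ ->] := @derive_prod_coord (fun j => derive1n (count_mem j s) (E j)) i x.
  by have [] := is_derive_derive1n (count_mem i s) (x ord0 i) (cE i).
rewrite [RHS](bigD1 i)//= eqxx add1n derive1nS; congr (_ * _).
by apply: eq_bigr => j ji; rewrite eq_sym (negbTE ji).
Qed.

Lemma smooth_prod_coord (E : 'I_n -> R -> R) : (forall i, Coo (E i)) ->
  smooth (fun x : 'rV[R]_n => \prod_j E j (x ord0 j)).
Proof.
move=> cE s; rewrite iter_partial_prod_coord//; split=> [|i x].
  apply: (@continuous_prod_coord (fun j => derive1n (count_mem j s) (E j))) => i.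
  exact: continuous_derive1n.
apply: (@derive_prod_coord (fun j => derive1n (count_mem j s) (E j)) i x _).1 => /=.
by have [] := is_derive_derive1n (count_mem i s) (x ord0 i) (cE i).
Qed.

Definition box (a b : 'I_n -> R) : set 'rV[R]_n :=
  [set x | forall i, a i < x ord0 i < b i].

Lemma not_box a b x : ~ box a b x -> exists i, ~~ (a i < x ord0 i < b i).
Proof. by move=> /existsNP[i /negP xi]; exists i. Qed.

Lemma box_exhaust x : exists k : nat, box (fun=> - k%:R) (fun=> k%:R) x.
Proof.
exists (Num.truncn (\sum_j `|x ord0 j|)).+1 => i; rewrite -ltr_norml.
apply: (@le_lt_trans _ _ (\sum_j `|x ord0 j|)); last exact: truncnS_gt.
by rewrite (bigD1 i)//= lerDl; apply: sumr_ge0.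
Qed.

Definition box_bump (k : nat) (a b : 'I_n -> R) (x : 'rV[R]_n) : R :=
  \prod_i bump k (a i) (b i) (x ord0 i).

Definition box_radius (a b : 'I_n -> R) : R := \sum_i (`|a i| + `|b i|).

Lemma box_sub_cube a b : box a b `<=` cube n (box_radius a b).
Proof.
move=> x xab i; have /andP[ax xb] := xab i.
have h : `|x ord0 i| <= `|a i| + `|b i|.
  rewrite ler_norml; apply/andP; split.
    by have := ler_norm (- a i); have := normr_ge0 (b i); rewrite normrN; lra.
  by have := ler_norm (b i); have := normr_ge0 (a i); lra.
rewrite (le_trans h)// /box_radius (bigD1 i)//= lerDl.
by apply: sumr_ge0 => j _; rewrite addr_ge0.
Qed.

Lemma box_bump_out k a b x : ~ box a b x -> box_bump k a b x = 0.
Proof.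
move=> /not_box[i xi].
by apply/eqP/prodf_eq0; exists i; rewrite // bump_out.
Qed.

Lemma box_bump_ge0 k a b x : 0 <= box_bump k a b x.
Proof. by apply: prodr_ge0 => i _; exact: bump_ge0. Qed.

Lemma box_bump_le1 k a b x : box_bump k a b x <= 1.
Proof. by apply: Num.Theory.prodr_ile1 => i _; rewrite bump_ge0 bump_le1. Qed.

Lemma box_bump_test k a b : test_function (box_bump k a b).
Proof.
split.
  by apply: (@smooth_prod_coord (fun i => bump k (a i) (b i))) => i; exact: Coo_bump.
apply: (subclosed_compact (@closed_closure _ _) (@compact_cube R n (box_radius a b))).
rewrite [X in _ `<=` X]((closure_id _).1 (@closed_cube R n (box_radius a b))).
apply: closure_subset => x /= /eqP bx; apply: box_sub_cube.
by apply: contrapT => xab; apply: bx; exact: box_bump_out.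
Qed.

Lemma box_bump_cvg a b x :
  box_bump k a b x @[k --> \oo] --> (\1_(box a b) x : R).
Proof.
have -> : \1_(box a b) x = \prod_i (\1_(`](a i), (b i)[%classic) (x ord0 i) : R).
  rewrite indicE; case: (pselect (box a b x)) => [xab|xab].
    rewrite mem_set// big1// => i _; rewrite indicE mem_set//= in_itv/=; exact: xab.
  have [i xi] := not_box xab.
  rewrite memNset//; apply/esym/eqP/prodf_eq0; exists i => //.
  by rewrite indicE memNset//= in_itv/=; exact/negP.
rewrite /box_bump; elim: (index_enum _) => [|i r IH].
  by under eq_fun do rewrite big_nil; rewrite big_nil; exact: cvg_cst.
by under eq_fun do rewrite big_cons; rewrite big_cons; apply: cvgM => //; exact: bump_cvg.
Qed.

Lemma measurable_box a b : measurable (box a b : set 'rV[RT]_n).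
Proof.
apply: (@measurable_coord_set R n (fun i => `](a i), (b i)[%classic)) => i.
exact: measurable_itv.
Qed.

Definition boxes : set (set 'rV[RT]_n) := [set A | exists a b, A = box a b].

Lemma boxesI : setI_closed boxes.
Proof.
move=> _ _ [a [b ->]] [a' [b' ->]].
exists (fun i => Num.max (a i) (a' i)), (fun i => Num.min (b i) (b' i)).
apply/seteqP; split => [x [h h'] i|x h].
  by rewrite gt_max lt_min; have /andP[-> ->] := h i; have /andP[-> ->] := h' i.
by split => i; have := h i; rewrite gt_max lt_min => /andP[/andP[? ?] /andP[? ?]]; apply/andP.
Qed.

(** The coordinates generate the sigma-algebra, and a strip between two values of
    one coordinate is a countable union of boxes. *)
Lemma measurable_boxesE : @measurable _ 'rV[RT]_n = <<s boxes >>.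
Proof.
apply/seteqP; split => A; last first.
  apply: smallest_sub; first exact: sigma_algebra_measurable.
  by move=> _ [a [b ->]]; exact: measurable_box.
apply: smallest_sub; first exact: smallest_sigma_algebra.
move=> B; rewrite -bigcup_seq => -[i _ [C mC <-]].
have mi : measurable_fun setT (row_coord i : g_sigma_algebraType boxes -> RT).
  apply: (measurability _ (RGenOpens.measurableE R)) => _ [_ [a [b ->] <-]].
  rewrite setTI (_ : _ @^-1` _ = \bigcup_k box (fun j => if j == i then a else - k%:R)
     (fun j => if j == i then b else k%:R)).
    by apply: bigcupT_measurable => k; apply: sub_sigma_algebra; eexists; eexists.
  apply/seteqP; split => x /=; last first.
    by move=> [k _ /(_ i)]; rewrite eqxx in_itv.
  rewrite in_itv/= => xab.
  have [k xk] := box_exhaust x.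
  by exists k => // j; case: eqVneq => [->//|_]; exact: xk.
exact: (mi measurableT _ mC).
Qed.

Lemma loc_integrable_cube (g : 'rV[R]_n -> R) B : loc_integrable g ->
  leb.-integrable (cube n B) (EFin \o g).
Proof.
move=> [mg ig]; apply/integrableP; split.
  by apply/measurable_EFinP; exact: measurable_funTS.
exact: (ig _ (@compact_cube R n B)).
Qed.

(** Dominated convergence; the bumps are at most 1 and live in a cube, on which
    [g] is integrable. *)
Lemma integral_box_cvg (g : 'rV[R]_n -> R) a b : loc_integrable g ->
  (forall k, leb.-integrable setT (fun x => (g x * box_bump k a b x)%:E)) /\
  (\int[leb]_x (g x * box_bump k a b x)%:E)%E @[k --> \oo] -->
    (\int[leb]_(x in box a b) (g x)%:E)%E.
Proof.
move=> lg; have mg := lg.1; pose D : set 'rV[R]_n := cube n (box_radius a b).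
have mD : measurable (D : set 'rV[RT]_n) by exact: measurable_cube.
have mb k : measurable_fun setT (box_bump k a b : 'rV[RT]_n -> R).
  apply: continuous_measurable_row.
  by have [/(_ [::])[]] := box_bump_test k a b.
have mgb k : measurable_fun setT (fun x : 'rV[RT]_n => g x * box_bump k a b x).
  exact: measurable_funM.
pose G : 'rV[RT]_n -> \bar R := (abse \o (EFin \o g)) \_ D.
have iG : leb.-integrable setT G.
  apply/integrable_restrict => //; rewrite setTI.
  by apply: integrable_abse; exact: loc_integrable_cube.
have leG k x : (`|(g x * box_bump k a b x)%:E| <= G x)%E.
  rewrite /G patchE; case: ifPn => [_|].
    rewrite /= lee_fin normrM ler_piMr// ger0_norm ?box_bump_ge0//.
    exact: box_bump_le1.
  rewrite notin_setE => xD; rewrite box_bump_out ?mulr0 ?abse0//.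
  by apply: contra_not xD; exact: box_sub_cube.
split=> [k|].
  apply: (le_integrable measurableT _ _ iG); first exact/measurable_EFinP.
  move=> x _; rewrite (le_trans (leG k x))//.
  by rewrite lee_abs.
have [] := @dominated_convergence _ _ _ leb setT measurableT
  (fun k x => (g x * box_bump k a b x)%:E) (fun x => (g x * \1_(box a b) x)%:E) G _ _ _ iG _.
- by move=> k; exact/measurable_EFinP.
- apply/measurable_EFinP; apply: measurable_funM => //.
  by apply: measurable_indic; exact: measurable_box.
- apply: aeW => x _; apply: cvg_EFin; first exact: nearW.
  by apply: cvgM; [exact: cvg_cst|exact: box_bump_cvg].
- by apply: aeW => x k _; exact: leG.
move=> _ _; rewrite [X in _ --> X -> _](_ : _ = (\int[leb]_(x in box a b) (g x)%:E)%E)//.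
rewrite [RHS]integral_mkcond; apply: eq_integral => x _.
by rewrite patchE indicE; case: ifP; rewrite ?mulr1 ?mulr0.
Qed.

(** Testing against the bumps shows that both functions have the same integral
    over every box.  Boxes are stable under intersection and generate the
    sigma-algebra, so within a fixed cube the same holds for all measurable sets,
    and the functions agree almost everywhere on the cube. *)
Lemma weak_deriv_ae_unique (g1 g2 : 'rV[R]_n -> R) :
  loc_integrable g1 -> loc_integrable g2 ->
  (forall phi, test_function phi ->
     \int[leb]_x (g1 x * phi x) = \int[leb]_x (g2 x * phi x)) ->
  ae_eq leb setT (EFin \o g1) (EFin \o g2).
Proof.
move=> l1 l2 g12.
have boxE a b : (\int[leb]_(x in box a b) (g1 x)%:E =
                 \int[leb]_(x in box a b) (g2 x)%:E)%E.
  have [i1 c1] := integral_box_cvg a b l1; have [i2 c2] := integral_box_cvg a b l2.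
  suff e : (fun k => (\int[leb]_x (g1 x * box_bump k a b x)%:E)%E) =
    (fun k => (\int[leb]_x (g2 x * box_bump k a b x)%:E)%E).
    by rewrite e in c1; exact: (cvg_unique _ c1 c2).
  apply/funext => k; have := g12 _ (box_bump_test k a b).
  rewrite /Rintegral => h.
  by rewrite -[LHS]fineK ?integrable_fin_num// h fineK ?integrable_fin_num.
pose Q (m : nat) : set 'rV[RT]_n := box (fun=> - m%:R) (fun=> m%:R).
have mQ m : measurable (Q m) by exact: measurable_box.
have iQ g m E : loc_integrable g -> measurable E -> leb.-integrable (E `&` Q m) (EFin \o g).
  move=> lg mE; apply: (integrableS _ _ _
    (loc_integrable_cube (box_radius (fun=> - m%:R) (fun=> m%:R)) lg)).
  - exact: measurable_cube.
  - exact: measurableI.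
  - by move=> x [_ /box_sub_cube].
have QE m E : measurable E ->
    (\int[leb]_(x in E `&` Q m) (g1 x)%:E = \int[leb]_(x in E `&` Q m) (g2 x)%:E)%E.
  rewrite measurable_boxesE.
  move: E; apply: (dynkin_induction measurable_boxesE boxesI).
  - by rewrite setTI; exact: boxE.
  - move=> _ [a [b ->]]; have [a' [b' ->]] : boxes (box a b `&` Q m).
      by apply: boxesI; eexists; eexists.
    exact: boxE.
  - move=> E mE PE.
    have split_E g : loc_integrable g -> (\int[leb]_(x in Q m) (g x)%:E =
       \int[leb]_(x in E `&` Q m) (g x)%:E + \int[leb]_(x in ~` E `&` Q m) (g x)%:E)%E.
      move=> lg; rewrite -integral_setU.
      - by rewrite -setIUl setUv setTI.
      - exact: measurableI.
      - by apply: measurableI => //; exact: measurableC.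
      - by apply/measurable_EFinP; apply: measurable_funTS; case: lg.
      - by apply/disj_setPS => x [[Ex _] [nEx _]].
    have := boxE (fun=> - m%:R) (fun=> m%:R); rewrite -/(Q m) (split_E _ l1) (split_E _ l2) PE.
    move/(congr1 (fun y => y - \int[leb]_(x in E `&` Q m) (g2 x)%:E)%E).
    have fin : (\int[leb]_(x in E `&` Q m) (g2 x)%:E)%E \is a fin_num.
      by apply: (integrable_fin_num (measurableI _ _ mE (mQ m))); exact: iQ.
    by rewrite ![(_ + \int[leb]_(x in ~` _ `&` _) _)%E]addeC !addeK.
  - move=> F mF tF PF; rewrite !setI_bigcupl.
    have tFQ : trivIset setT (fun k => F k `&` Q m).
      by apply: trivIset_setIr.
    rewrite !integral_bigcup//.
    - by apply: eq_eseriesr => k _; exact: PF.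
    - by move=> k; exact: measurableI.
    - by rewrite -setI_bigcupl; apply: iQ => //; exact: bigcupT_measurable.
    - by move=> k; exact: measurableI.
    - by rewrite -setI_bigcupl; apply: iQ => //; exact: bigcupT_measurable.
have aeQ m : {ae leb, forall x, Q m x -> (EFin \o g1) x = (EFin \o g2) x}.
  apply: (@integral_ae_eq _ _ _ leb (Q m) (mQ m) (EFin \o g2) (EFin \o g1)).
  - by have := iQ g1 m setT l1 measurableT; rewrite setTI.
  - by apply/measurable_EFinP; apply: measurable_funTS; case: l2.
  - by move=> E EQ mE; have := QE m _ mE; rewrite (setIidl EQ).
have := ae_foralln aeQ; apply: filterS => x hx _.
by have [k xk] := box_exhaust x; exact: (hx k).
Qed.

End weak_derivative_unique.

(** * Weak derivatives of a function of the first coordinate *)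

Section weak_derivative_of_coordinate_function.
Context {R : realType} {n : nat}.
Local Notation RT := (measurableTypeR R).
Local Notation leb := (@lebesgue_row R n.+1).
Implicit Types (f g : R -> R) (phi psi : 'rV[R]_n.+1 -> R).

Lemma test_function_cube phi : test_function phi ->
  exists2 B, 0 <= B & forall x, ~ cube n.+1 B x -> phi x = 0.
Proof.
move=> [_ /compact_sub_cube[B B0 hB]]; exists B => // x xB.
apply: contrapT => px; apply: xB; apply: hB; apply: subset_closure.
exact/eqP.
Qed.

Lemma iter_partial_out_cube phi B s x : (forall x, ~ cube n.+1 B x -> phi x = 0) ->
  ~ cube n.+1 B x -> iter_partial s phi x = 0.
Proof.
move=> p0; elim: s x => [|i s IH] x xB /=; first exact: p0.
exact: derive_out_cube xB.
Qed.

Lemma continuous_fst_coord f : continuous f ->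
  continuous (fun x : 'rV[R]_n.+1 => f (x ord0 ord0)).
Proof.
move=> cf x; apply: (@continuous_comp _ _ _ (fun x : 'rV[R]_n.+1 => x ord0 ord0) f).
  exact: coord_continuous.
exact: cf.
Qed.

Lemma derive_fst_coord f i (x : 'rV[R]_n.+1) : derivable f (x ord0 ord0) 1 ->
  derivable (fun x : 'rV[R]_n.+1 => f (x ord0 ord0)) x (unit_row i) /\
  'D_(unit_row i) (fun x : 'rV[R]_n.+1 => f (x ord0 ord0)) x =
  if i == ord0 then derive1 f (x ord0 ord0) else 0.
Proof.
move=> df; case: eqVneq => [->|i0].
  have lineE (t : R) : f (t *: (1 : R) + x ord0 ord0) =
      f ((t *: unit_row ord0 + x) ord0 ord0).
    by rewrite unit_row_lineE eqxx.
  have [h <-] := @derive_on_line _ R 'rV[R]_n.+1 f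
    (fun x => f (x ord0 ord0)) _ _ _ _ lineE.
  by split; [exact: h|rewrite derive1E].
have lineE (t : R) : cst (f (x ord0 ord0)) (t *: (1 : R) + 0) =
    f ((t *: unit_row i + x) ord0 ord0).
  by rewrite unit_row_lineE eq_sym (negbTE i0) mulr0 add0r.
have [h <-] := @derive_on_line _ R 'rV[R]_n.+1 _
  (fun x => f (x ord0 ord0)) _ _ _ _ lineE.
by split; [apply: h|rewrite derive_cst].
Qed.

(** The partial derivative of the product [g * psi] has integral 0. *)
Lemma integration_by_parts_fst g i psi B : Coo g ->
  (forall x, derivable psi x (unit_row i)) -> continuous psi ->
  continuous ('D_(unit_row i) psi) ->
  (forall x, ~ cube n.+1 B x -> psi x = 0) ->
  \int[leb]_x (g (x ord0 ord0) * 'D_(unit_row i) psi x) =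
  - \int[leb]_x ((if i == ord0 then derive1 g (x ord0 ord0) else 0) * psi x).
Proof.
move=> cg dpsi cpsi cdpsi psi0.
pose G (x : 'rV[R]_n.+1) : R := g (x ord0 ord0); pose G' x : R := 'D_(unit_row i) G x.
have [dg cg'] := Coo_derive cg.
have cG : continuous (G : 'rV[R]_n.+1 -> R).
  exact: (@continuous_fst_coord g (@continuous_derive1n _ g 0 cg)).
have dG x : derivable G x (unit_row i) by exact: (derive_fst_coord i (dg _)).1.
have GE (x : 'rV[R]_n.+1) : (if i == ord0 then derive1 g (x ord0 ord0) else 0) = G' x.
  by rewrite [RHS](derive_fst_coord i (dg _)).2.
have cG' : continuous (G' : 'rV[R]_n.+1 -> R).
  rewrite (_ : G' = fun x : 'rV[R]_n.+1 => if i == ord0 then derive1 g (x ord0 ord0) else 0).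
    case: (i == ord0).
      exact: (@continuous_fst_coord (derive1 g) (@continuous_derive1n _ g 1 cg)).
    exact: cst_continuous.
  by apply/funext => x; rewrite GE.
have intg (h1 h2 : 'rV[R]_n.+1 -> R) : continuous h1 -> continuous h2 ->
    (forall x, ~ cube n.+1 B x -> h2 x = 0) ->
    leb.-integrable setT (EFin \o (fun x => h1 x * h2 x)).
  move=> c1 c2 h0; have c12 : continuous (fun x => h1 x * h2 x).
    by move=> x; apply: continuousM; [exact: c1|exact: c2].
  have h120 x : ~ cube n.+1 B x -> h1 x * h2 x = 0 by move=> /h0 ->; rewrite mulr0.
  have [C C0 hC] := bounded_on_cube c12 h120.
  by apply: (integrable_cube _ hC h120); exact: continuous_measurable_row.
have dpsi0 x : ~ cube n.+1 B x -> 'D_(unit_row i) psi x = 0 by exact: derive_out_cube.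
under [in RHS]eq_Rintegral do rewrite GE.
apply/eqP; rewrite -addr_eq0 -RintegralD//; [|exact: intg..].
have dM x : is_derive x (unit_row i) (fun x => G x * psi x)
    (G x * 'D_(unit_row i) psi x + G' x * psi x).
  have := is_deriveM (derivableP (dG x)) (derivableP (dpsi x)).
  by rewrite /GRing.scale/= [psi x * _]mulrC.
have := @integral_derive_eq0 R n.+1 i (fun x => G x * psi x) B.
rewrite /Rintegral => h; apply/eqP.
rewrite -[RHS](_ : fine 0 = 0)// -h.
- congr fine; apply: eq_integral => x _; congr EFin.
  by apply/esym; exact: derive_val.
- by move=> x; exact: ex_derive.
- rewrite (_ : 'D_(unit_row i) _ = (fun x => G x * 'D_(unit_row i) psi x + G' x * psi x)).
    by move=> x; exact: (cvgD (cvgM (cG x) (cdpsi x)) (cvgM (cG' x) (cpsi x))).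
  by apply/funext => x; exact: derive_val.
- by move=> x /psi0 ->; rewrite mulr0.
Qed.

(** The iterated partial derivative of [g (x ord0 ord0)] along [s], which vanishes
    as soon as [s] contains another coordinate. *)
Definition fst_deriv g (s : seq 'I_n.+1) (x : 'rV[R]_n.+1) : R :=
  if all (pred1 ord0) s then derive1n (size s) g (x ord0 ord0) else 0.

(** Each integration by parts moves the outermost derivative of [phi] to [g], which
    therefore has to vary in the induction. *)
Lemma integral_iter_partial_fst g phi s : Coo g -> test_function phi ->
  \int[leb]_x (g (x ord0 ord0) * iter_partial s phi x) =
  (-1) ^+ size s * \int[leb]_x (fst_deriv g s x * phi x).
Proof.
move=> cg tphi; have [B B0 phi0] := test_function_cube tphi.
elim: s g cg => [|i s IH] g cg; first by rewrite expr0 mul1r.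
have [cs ds] := tphi.1 s; have [cis _] := tphi.1 (i :: s).
rewrite /= (integration_by_parts_fst cg (ds i) cs cis (B := B)); last first.
  by move=> x; exact: iter_partial_out_cube.
rewrite /fst_deriv /= exprS mulN1r mulNr; congr (- _).
have [_ cg'] := Coo_derive cg.
case: eqVneq => [_|_] /=.
  by rewrite (IH _ cg'); congr (_ * _); apply: eq_Rintegral => x _;
    rewrite /fst_deriv -derive1Sn.
under eq_Rintegral do rewrite mul0r; under [in RHS]eq_Rintegral do rewrite mul0r.
by rewrite /Rintegral integral0 mulr0.
Qed.

Lemma continuous_fst_deriv g s : Coo g -> continuous (fst_deriv g s).
Proof.
move=> cg; rewrite /fst_deriv; case: (all _ _); last by move=> x; exact: cst_continuous.
exact: (@continuous_fst_coord (derive1n (size s) g) (@continuous_derive1n _ g _ cg)).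
Qed.

(** A compact set lies in a cube, so it has finite measure. *)
Lemma continuous_loc_integrable (h : 'rV[R]_n.+1 -> R) : continuous h -> loc_integrable h.
Proof.
move=> ch; split; first exact: continuous_measurable_row.
move=> K cK; have [C C0 hC] := compact_bounded_fun ch cK.
have [B B0 KB] := compact_sub_cube cK.
have mK : measurable (K : set 'rV[RT]_n.+1).
  rewrite -[K]setCK; apply: measurableC; apply: open_measurable_row.
  by apply/closed_openC; apply: compact_closed; [exact: norm_hausdorff|exact: cK].
have lK : (leb K < +oo)%E.
  apply: le_lt_trans (lebesgue_cube n.+1 B).
  by rewrite le_measure ?inE//; exact: measurable_cube.
have : leb.-integrable K (EFin \o h).
  apply: (@integrable_bounded_on _ _ _ _ C) => //.
  by apply: measurable_funTS; exact: continuous_measurable_row.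
by case/integrableP.
Qed.

(** The order in which [multi_partial] differentiates. *)
Definition mult_seq (r : 'I_n.+1 -> nat) : seq 'I_n.+1 :=
  flatten [seq nseq (r i) i | i <- enum 'I_n.+1].

Lemma size_mult_seq r : size (mult_seq r) = \sum_i r i.
Proof.
rewrite size_flatten /shape -map_comp sumnE big_map big_enum/=.
by apply: eq_bigr => i _; rewrite size_nseq.
Qed.

Lemma is_weak_deriv_fst g r : Coo g ->
  is_weak_deriv r (fun x => g (x ord0 ord0)) (fst_deriv g (mult_seq r)).
Proof.
move=> cg; split; first by apply: continuous_loc_integrable; exact: continuous_fst_deriv.
by move=> phi tphi; rewrite /multi_partial integral_iter_partial_fst// size_mult_seq.
Qed.

Lemma weak_deriv_fst_ae g r : Coo g ->
  measurable_fun setT (weak_deriv r (fun x => g (x ord0 ord0)) : 'rV[RT]_n.+1 -> R) /\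
  ae_eq leb setT (EFin \o weak_deriv r (fun x => g (x ord0 ord0)))
    (EFin \o fst_deriv g (mult_seq r)).
Proof.
move=> cg; have wd := is_weak_deriv_fst r cg.
have wd' : is_weak_deriv r (fun x => g (x ord0 ord0))
    (weak_deriv r (fun x => g (x ord0 ord0))).
  by rewrite /weak_deriv; apply: getPex; exists (fst_deriv g (mult_seq r)).
split; first by case: wd' => -[].
apply: weak_deriv_ae_unique; [by case: wd'|by case: wd|] => phi tphi.
have := wd'.2 _ tphi; rewrite wd.2//.
by move/mulfI => -> //; rewrite signr_eq0.
Qed.

End weak_derivative_of_coordinate_function.

(** * Gaussian norms and the worst-case error *)

Section gaussian_norms.
Context {R : realType}.
Local Notation RT := (measurableTypeR R).
Local Notation leb := (@lebesgue_row R).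
Local Notation pdf := (@normal_pdf R 0 1).

Lemma gauss_density_ge0 n (x : 'rV[R]_n) : 0 <= gauss_density x.
Proof. by rewrite mulr_ge0 ?powR_ge0 ?expR_ge0. Qed.

Lemma gauss_density_cons n (x : R) (y : 'rV[R]_n) :
  gauss_density (row_cons (x, y) : 'rV[R]_n.+1) = pdf x * gauss_density y.
Proof.
rewrite normal_pdfE ?oner_eq0// /gauss_density big_ord_recl row_cons0/=.
under eq_bigr do rewrite row_consS/=.
rewrite /normal_peak /normal_fun.
have -> : - (x ^+ 2 + \sum_i y ord0 i ^+ 2) / 2 =
    - (x - 0) ^+ 2 / (1 ^+ 2 *+ 2) + (- (\sum_i y ord0 i ^+ 2) / 2).
  by rewrite subr0 expr1n; field.
rewrite expRD [in RHS]mulrACA; congr (_ * _).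
have -> : (1 ^+ 2 * pi *+ 2) = 2 * pi :> R by rewrite expr1n mul1r mulr_natl.
have p0 : 0 < 2 * pi :> R by rewrite mulr_gt0// pi_gt0.
have -> : (Num.sqrt (2 * pi))^-1 = (2 * pi) `^ (- (1 / 2)) :> R.
  by rewrite powRN div1r powR12_sqrt// ltW.
rewrite -powRD; last by rewrite (gt_eqF p0) implybT.
by congr (_ `^ _); rewrite -addn1 natrD; field.
Qed.

Lemma continuous_gauss_density n : continuous (@gauss_density R n).
Proof.
pose E (t : R) := expR (- t ^+ 2 / 2).
have -> : @gauss_density R n =
    (fun x => (2 * pi) `^ (- (n%:R / 2)) * \prod_i E (x ord0 i)).
  apply/funext => x; rewrite /gauss_density -expR_sum; congr (_ * expR _).
  by rewrite -mulr_suml sumrN.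
have cE : continuous E.
  move=> t; apply: (@continuous_comp R R R (fun t : R => - t ^+ 2 / 2) expR).
    by apply: cvgM; [apply: cvgN; exact: exprn_continuous|exact: cvg_cst].
  exact: continuous_expR.
move=> x; apply: (@continuousM _ 'rV[R]_n (cst ((2 * pi) `^ (- (n%:R / 2))))
  (fun x : 'rV[R]_n => \prod_i E (x ord0 i)) x); first exact: cst_continuous.
exact: (@continuous_prod_coord R n (fun=> E) (fun=> cE)).
Qed.

Lemma measurable_gauss_density n : measurable_fun setT (@gauss_density R n : 'rV[RT]_n -> R).
Proof. by apply: continuous_measurable_row; exact: continuous_gauss_density. Qed.

Lemma integral_gauss_density n : (\int[leb n]_x (gauss_density x)%:E = 1%E)%E.
Proof.
elim: n => [|n IH].
  rewrite [LHS](@integral_dirac _ 'rV[RT]_0)//; last first.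
    apply/measurable_EFinP; exact: measurable_gauss_density.
  rewrite diracT mul1e /gauss_density big_ord0 oppr0 !mul0r expR0 oppr0.
  rewrite powRr0 mulr1.
  by [].
rewrite ge0_integral_lebesgue_rowS; last 2 first.
- apply/measurable_EFinP; exact: measurable_gauss_density.
- by move=> x; rewrite lee_fin gauss_density_ge0.
rewrite -[RHS](@integral_normal_pdf R 0 1)//; apply: eq_integral => x _.
under eq_integral do rewrite gauss_density_cons EFinM.
rewrite ge0_integralZl//.
- by rewrite IH mule1.
- apply/measurable_EFinP; exact: measurable_gauss_density.
- by move=> y _; rewrite lee_fin gauss_density_ge0.
- by rewrite lee_fin normal_pdf_ge0.
Qed.

Lemma integrable_gauss_bounded n (h : 'rV[RT]_n -> R) C :
  measurable_fun setT h -> (forall x, `|h x| <= C) ->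
  (leb n).-integrable setT (EFin \o (fun x => h x * gauss_density x)).
Proof.
move=> mh hC.
have id : (leb n).-integrable setT (fun x => (C * gauss_density x)%:E).
  apply/integrableP; split.
    by apply/measurable_EFinP; apply: measurable_funM => //; exact: measurable_gauss_density.
  under eq_integral do rewrite /= normrM EFinM (ger0_norm (gauss_density_ge0 _)).
  rewrite ge0_integralZl//.
  - by rewrite integral_gauss_density mule1 ltry.
  - apply/measurable_EFinP; exact: measurable_gauss_density.
  - by move=> y _; rewrite lee_fin gauss_density_ge0.
apply: (le_integrable measurableT _ _ id).
  by apply/measurable_EFinP; apply: measurable_funM => //; exact: measurable_gauss_density.
move=> x _; rewrite /= lee_fin !normrM ler_wpM2r// (le_trans (hC x))//.
exact: ler_norm.
Qed.

Lemma gauss_int_cst n (c : R) : \int[leb n]_x (c * gauss_density x) = c.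
Proof.
rewrite RintegralZl//; last first.
  have := @integrable_gauss_bounded n (cst 1) 1 (measurable_cst _) _.
  rewrite (_ : EFin \o _ = EFin \o (@gauss_density R n)); last first.
    by apply/funext => x /=; rewrite mul1r.
  by apply=> x; rewrite normr1.
by rewrite /Rintegral integral_gauss_density/= mulr1.
Qed.

Lemma gauss_int_fst n (g : R -> R) : measurable_fun setT g -> (forall x, 0 <= g x) ->
  gauss_int (fun x : 'rV[R]_n.+1 => g (x ord0 ord0)) =
  \int[@lebesgue_measure R]_x (g x * pdf x).
Proof.
move=> mg g0; rewrite /gauss_int /Rintegral; congr fine.
rewrite ge0_integral_lebesgue_rowS; last 2 first.
- apply/measurable_EFinP; apply: measurable_funM; last exact: measurable_gauss_density.
  by apply: measurableT_comp => //; exact: measurable_row_coord.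
- by move=> x; rewrite lee_fin mulr_ge0// gauss_density_ge0.
apply: eq_integral => x _.
transitivity (\int[leb n]_y ((g x * pdf x)%:E * (gauss_density y)%:E))%E.
  by apply: eq_integral => y _; rewrite gauss_density_cons row_cons0 mulrA EFinM.
rewrite ge0_integralZl//.
- by rewrite integral_gauss_density mule1.
- apply/measurable_EFinP; exact: measurable_gauss_density.
- by move=> y _; rewrite lee_fin gauss_density_ge0.
- by rewrite lee_fin mulr_ge0// normal_pdf_ge0.
Qed.


(** This bounds the order of a nonzero derivative by the largest entry of [r]
    instead of by its sum, which would cost a power of the number of nodes. *)
Lemma mult_seq_all_fst n (r : 'I_n.+1 -> nat) :
  all (pred1 ord0) (mult_seq r) -> size (mult_seq r) = r ord0.
Proof.
move=> /allP h; rewrite size_mult_seq (bigD1 ord0)//= big1 ?addr0// => i i0.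
apply/eqP; rewrite -leqn0 leqNgt; apply/negP => ri.
have : i \in mult_seq r.
  apply/flattenP; exists (nseq (r i) i); last by rewrite mem_nseq ri eqxx.
  by apply/mapP; exists i => //; rewrite mem_enum.
by move/h => /=; rewrite (negbTE i0).
Qed.

Lemma fst_deriv_bound n (g : R -> R) (a : nat) (B : R) (r : 'I_n.+1 -> nat) x :
  0 <= B -> (forall k y, (k <= a)%N -> `|derive1n k g y| <= B) -> (r ord0 <= a)%N ->
  `|fst_deriv g (mult_seq r) x| <= B.
Proof.
move=> B0 gB ra; rewrite /fst_deriv; case: ifPn => [h|_]; last by rewrite normr0.
by apply: gB; rewrite (mult_seq_all_fst h).
Qed.

(** The weak derivative selected in the norm is unknown, but it agrees almost
    everywhere with the classical one. *)
Lemma L2gauss_norm_weak_deriv_fst n (g : R -> R) (r : 'I_n.+1 -> nat) : Coo g ->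
  L2gauss_norm (weak_deriv r (fun x : 'rV[R]_n.+1 => g (x ord0 ord0))) ^+ 2 =
  \int[leb n.+1]_x (fst_deriv g (mult_seq r) x ^+ 2 * gauss_density x).
Proof.
move=> cg; have [mw aw] := weak_deriv_fst_ae r cg.
rewrite sqr_sqrtr; last first.
  by apply: Rintegral_ge0 => x _; rewrite mulr_ge0 ?sqr_ge0// gauss_density_ge0.
rewrite /Rintegral; congr fine.
have mh : measurable_fun setT (fst_deriv g (mult_seq r) : 'rV[RT]_n.+1 -> R).
  by apply: continuous_measurable_row; exact: continuous_fst_deriv.
apply: ae_eq_integral => //.
- apply/measurable_EFinP; apply: measurable_funM; first exact: measurable_funX.
  exact: measurable_gauss_density.
- apply/measurable_EFinP; apply: measurable_funM; first exact: measurable_funX.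
  exact: measurable_gauss_density.
- apply: filterS aw => x /(_ I)[e] _.
  by rewrite e.
Qed.

Lemma L2gauss_bounded n (h : 'rV[R]_n -> R) (B : R) :
  measurable_fun setT (h : 'rV[RT]_n -> R) ->
  (forall x, `|h x| <= B) ->
  L2gauss h /\ \int[leb n]_x (h x ^+ 2 * gauss_density x) <= B ^+ 2.
Proof.
move=> mh hB.
have h2B x : `|h x ^+ 2| <= B ^+ 2 by rewrite normrX lerXn2r ?nnegrE// (le_trans _ (hB x)).
have ih : (leb n).-integrable setT (EFin \o (fun x => h x ^+ 2 * gauss_density x)).
  by apply: integrable_gauss_bounded h2B; exact: measurable_funX.
split; first by split.
rewrite -[leRHS](gauss_int_cst n); apply: le_Rintegral => //.
  apply: (@integrable_gauss_bounded _ (cst (B ^+ 2)) (B ^+ 2)) => // x.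
  by rewrite /= ger0_norm ?sqr_ge0.
by move=> x _; rewrite ler_wpM2r ?gauss_density_ge0// (le_trans (ler_norm _)).
Qed.

(** Cauchy-Schwarz for the Gaussian probability, obtained by integrating
    [(h - I) ^+ 2 >= 0] with [I] the mean of [h]. *)
Lemma gauss_int_sqr n (h : 'rV[R]_n -> R) (B : R) :
  measurable_fun setT (h : 'rV[RT]_n -> R) ->
  (forall x, `|h x| <= B) ->
  gauss_int h ^+ 2 <= \int[leb n]_x (h x ^+ 2 * gauss_density x).
Proof.
move=> mh hB; set I := gauss_int h.
have [[_ ih2] _] := L2gauss_bounded mh hB.
have ih : (leb n).-integrable setT (EFin \o (fun x => h x * gauss_density x)).
  exact: integrable_gauss_bounded hB.
have ic (c : R) : (leb n).-integrable setT (EFin \o (fun x => c * gauss_density x)).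
  by apply: (@integrable_gauss_bounded _ (cst c) `|c|).
have i2 : (leb n).-integrable setT (EFin \o (fun x => 2 * I * (h x * gauss_density x))).
  rewrite (_ : (fun x => _) = (fun x => (2 * I * h x) * gauss_density x)).
    apply: (@integrable_gauss_bounded _ _ (`|2 * I| * B)) => [|x].
      exact: measurable_funM.
    by rewrite normrM ler_wpM2l.
  by apply/funext => x; rewrite mulrA.
have -> : I ^+ 2 = \int[leb n]_x (2 * I * (h x * gauss_density x) - I ^+ 2 * gauss_density x).
  rewrite RintegralB// RintegralZl// gauss_int_cst -/(gauss_int h) -/I; ring.
apply: le_Rintegral => //.
  rewrite (_ : (fun x => _) = (fun x => (2 * I * h x - I ^+ 2) * gauss_density x)).
    apply: (@integrable_gauss_bounded _ _ (`|2 * I| * B + I ^+ 2)) => [|x].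
      by apply: measurable_funB => //; exact: measurable_funM.
    rewrite (le_trans (ler_normB _ _))// lerD//; last by rewrite ger0_norm ?sqr_ge0.
    by rewrite normrM ler_wpM2l.
  by apply/funext => x; ring.
move=> x _; rewrite -subr_ge0.
rewrite (_ : _ - _ = (h x - I) ^+ 2 * gauss_density x); last by ring.
by rewrite mulr_ge0 ?sqr_ge0// gauss_density_ge0.
Qed.

(** The upper bound on the norm gives the estimate.  A positive lower bound is
    needed as well, because a quotient by 0 is 0; it comes from
    [gauss_int_sqr]. *)
Lemma worst_case_error_fst n a (S : ('rV[R]_n.+1 -> R) -> R) (g : R -> R) (B : R) :
  Coo g -> (forall x, 0 <= g x) ->
  (forall k y, (k <= a)%N -> `|derive1n k g y| <= B) ->
  0 < \int[@lebesgue_measure R]_x (g x * pdf x) ->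
  S (fun x => g (x ord0 ord0)) = 0 ->
  (((\int[@lebesgue_measure R]_x (g x * pdf x)) /
    (Num.sqrt #|{: {ffun 'I_n.+1 -> 'I_a.+1}}|%:R * B))%:E <= worst_case_error a S)%E.
Proof.
move=> cg g0 gB I0 S0.
set f := fun x : 'rV[R]_n.+1 => _ in S0.
set I := Rintegral _ _ _ in I0 *.
have mg : measurable_fun setT g.
  by apply: continuous_measurable_fun; exact: (@continuous_derive1n _ g 0 cg).
have IE : gauss_int f = I by exact: gauss_int_fst.
have B0 : 0 <= B := le_trans (normr_ge0 _) (gB 0%N 0 (leq0n _)).
have cf : continuous f by exact: (@continuous_fst_coord _ _ g (@continuous_derive1n _ g 0 cg)).
have mf : measurable_fun setT (f : 'rV[RT]_n.+1 -> R) by exact: continuous_measurable_row.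
have fB x : `|f x| <= B by exact: (gB 0%N).
have mD r : measurable_fun setT (fst_deriv g (mult_seq r) : 'rV[RT]_n.+1 -> R).
  by apply: continuous_measurable_row; exact: continuous_fst_deriv.
have DB (r : {ffun 'I_n.+1 -> 'I_a.+1}) x : `|fst_deriv g (mult_seq (fun i => r i)) x| <= B.
  by apply: fst_deriv_bound gB _ => //; rewrite -ltnS.
have Wf : gauss_sobolev a f.
  split=> // r; exists (fst_deriv g (mult_seq (fun i => r i))).
    exact: is_weak_deriv_fst.
  exact: (L2gauss_bounded (mD _) (DB r)).1.
have normub : gauss_sobolev_norm a f <= Num.sqrt #|{: {ffun 'I_n.+1 -> 'I_a.+1}}|%:R * B.
  rewrite -[X in _ * X](ger0_norm B0) -sqrtr_sqr -sqrtrM// ler_wsqrtr//.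
  rewrite mulr_natl -sumr_const; apply: ler_sum => r _.
  rewrite L2gauss_norm_weak_deriv_fst//; exact: (L2gauss_bounded (mD _) (DB r)).2.
have normlb : I <= gauss_sobolev_norm a f.
  rewrite -[I]ger0_norm ?(ltW I0)// -sqrtr_sqr ler_wsqrtr//.
  rewrite (bigD1 [ffun=> ord0])//= -[X in X <= _]addr0 lerD ?sumr_ge0//; last first.
    by move=> r _; exact: sqr_ge0.
  rewrite L2gauss_norm_weak_deriv_fst// -IE (le_trans (gauss_int_sqr mf fB))//.
  rewrite (_ : fst_deriv g _ = f)//.
  rewrite /fst_deriv (_ : mult_seq _ = [::])//.
  by apply: size0nil; rewrite size_mult_seq big1// => i _; rewrite ffunE.
have norm0 := lt_le_trans I0 normlb.
apply: ereal_sup_ge; exists (`|gauss_int f - S f| / gauss_sobolev_norm a f)%:E.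
  exists f => //; split => // f0.
  move: I0; rewrite -IE f0 /gauss_int; under eq_Rintegral do rewrite mul0r.
  by rewrite /Rintegral integral0 ltxx.
rewrite lee_fin IE S0 subr0 gtr0_norm// ler_pM2l// lef_pV2// posrE.
exact: lt_le_trans normub.
Qed.

End gaussian_norms.

(** * The sparse quadrature of a function of the first coordinate *)

Section sparse_grid_of_coordinate_function.
Context {R : realType}.

(** Distributivity over functions whose codomain depends on the argument: pass
    through functions into the disjoint union of the codomains. *)
Lemma sum_dffun_prod (I : finType) (T_ : I -> finType) (F : forall i, T_ i -> R) :
  \sum_(t : {dffun forall i, T_ i}) \prod_i F i (t i) =
  \prod_i \sum_(j : T_ i) F i j.
Proof.
rewrite (reindex (@dffun_of_fprod _ T_)); last exact/onW_bij/dffun_of_fprod_bij.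
transitivity (\sum_(t : fprod T_) \prod_(i in I) [ffun j => F i j] (t i)).
  by apply: eq_bigr => t _; apply: eq_bigr => i _; rewrite !ffunE.
rewrite (@big_fprod R 0 1 *%R +%R I T_ (fun i => [ffun j => F i j])).
rewrite -(bigA_distr_big_dep (tagged_with T_) (fun i g => untag 0 [ffun j => F i j] g)).
apply: eq_bigr => i _; rewrite -(big_tag (fun i : I => [ffun j => F i j] : T_ i -> R)).
by apply: eq_bigr => j _; rewrite ffunE.
Qed.

Lemma sum_nth_rule (q : @rule R) (h : R -> R) :
  \sum_(k < size q) (nth 0 q k).1 * h (nth 0 q k).2 = rule_eval q h.
Proof.
by rewrite /rule_eval (big_nth 0) big_mkord.
Qed.

Lemma tensor_eval_fst n (q : 'I_n.+1 -> @rule R) (g : R -> R) :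
  tensor_eval q (fun x : 'rV[R]_n.+1 => g (x ord0 ord0)) =
  rule_eval (q ord0) g * \prod_(j < n) rule_eval (q (lift ord0 j)) (cst 1).
Proof.
pose h (j : 'I_n.+1) : R -> R := if j == ord0 then g else cst 1.
transitivity (\sum_(i : {dffun forall j : 'I_n.+1, 'I_(size (q j))})
   \prod_j ((nth 0 (q j) (i j)).1 * h j (nth 0 (q j) (i j)).2)).
  apply: eq_bigr => i _; rewrite mxE big_split/=; congr (_ * _).
  by rewrite big_ord_recl big1 ?mulr1.
rewrite (sum_dffun_prod (fun j (k : 'I_(size (q j))) =>
  (nth 0 (q j) k).1 * h j (nth 0 (q j) k).2)).
rewrite big_ord_recl sum_nth_rule; congr (_ * _).
by apply: eq_bigr => j _; rewrite sum_nth_rule.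
Qed.

Lemma rule_eval_cat (p q : @rule R) h : rule_eval (p ++ q) h = rule_eval p h + rule_eval q h.
Proof. exact: big_cat. Qed.

Lemma rule_eval_opp (p : @rule R) h : rule_eval (rule_opp p) h = - rule_eval p h.
Proof. by rewrite /rule_eval big_map -sumrN; apply: eq_bigr => i _; rewrite mulNr. Qed.

Lemma rule_eval_nil h : @rule_eval R [::] h = 0.
Proof. exact: big_nil. Qed.

Lemma rule_eval_Delta (Q : nat -> @rule R) l h :
  rule_eval (Delta Q l.+1) h = rule_eval (level Q l.+1) h - rule_eval (level Q l) h.
Proof. by rewrite rule_eval_cat rule_eval_opp. Qed.

(** The factor [Delta_l (1)] of a coordinate other than the first is 1 for [l = 1]
    and 0 for [l > 1].  So only the levels [(k, 1, ..., 1)] contribute, with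
    [k <= L - n], and the sum of the [Delta_k] telescopes. *)
Lemma sparse_quad_fst n L (Q : nat -> @rule R) (g : R -> R) : (n < L)%N ->
  (forall l, (0 < l)%N -> rule_eval (Q l) (cst 1) = 1) ->
  sparse_quad Q (simplex_levels n.+1 L) (fun x : 'rV[R]_n.+1 => g (x ord0 ord0)) =
  rule_eval (Q (L - n)%N) g.
Proof.
move=> nL Q1.
have D1 l : (0 < l)%N -> rule_eval (Delta Q l) (cst 1) = (l == 1)%:R.
  case: l => [//|[|l]] _; rewrite rule_eval_Delta /= ?rule_eval_nil ?Q1//.
    by rewrite subr0.
  by rewrite subrr.
(* The level [(k, 1, ..., 1)]. *)
pose lv (k : 'I_L.+1) : {ffun 'I_n.+1 -> 'I_L.+1} :=
  [ffun j => if j == ord0 then k else inord 1].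
have inord1 : (inord 1 : 'I_L.+1) = 1%N :> nat by rewrite inordK// ltnS (leq_ltn_trans _ nL).
have lvE k (l : {ffun 'I_n.+1 -> 'I_L.+1}) :
    (l ord0 == k) && [forall j : 'I_n, l (lift ord0 j) == 1%N :> nat] = (l == lv k).
  apply/andP/eqP => [[/eqP lk /forallP l1]|->]; last first.
    split; first by rewrite ffunE eqxx.
    by apply/forallP => j; rewrite ffunE /= inord1.
  apply/ffunP => j; rewrite ffunE; case: (fintype.unliftP ord0 j) => [i ->|->] //=.
  by apply: val_inj; rewrite /= inord1; apply/eqP/l1.
rewrite /sparse_quad (eq_bigr (fun l : {ffun 'I_n.+1 -> 'I_L.+1} =>
  if l == lv (l ord0) then rule_eval (Delta Q (l ord0)) g else 0)); last first.
  move=> l; rewrite inE => /andP[/forallP l0 _]; rewrite tensor_eval_fst -lvE eqxx/=.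
  case: forallP => [h|h].
    by rewrite big1 ?mulr1// => j _; rewrite D1// h.
  have [j lj] : exists j : 'I_n, l (lift ord0 j) != 1%N :> nat.
    by have /existsNP[j /negP lj] := h; exists j.
  by rewrite (bigD1 j)//= D1// (negbTE lj) mul0r mulr0.
rewrite -big_mkcondr/=.
rewrite (reindex_onto lv (fun l => l ord0)) /=; last by move=> l /andP[_ /eqP].
have simE k : (lv k \in simplex_levels n.+1 L) = (0 < k <= L - n)%N.
  have sumE : (\sum_(j < n.+1) (lv k j : nat) = k + n)%N.
    rewrite big_ord_recl ffunE eqxx (eq_bigr (fun=> 1%N)) ?sum1_card ?card_ord//.
    by move=> j _; rewrite ffunE/= inord1.
  rewrite inE sumE; apply/andP/andP => [[/forallP/(_ ord0)]|[k0 kL]].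
    by rewrite ffunE eqxx => k0 kL; rewrite k0 leq_subRL 1?addnC// ltnW.
  split; last by rewrite addnC -leq_subRL// ltnW.
  by apply/forallP => j; rewrite ffunE; case: ifP; rewrite // inord1.
rewrite (eq_bigl (fun k : 'I_L.+1 => (0 < k < (L - n).+1)%N)); last first.
  by move=> k; rewrite simE ltnS ffunE !eqxx !andbT.
under eq_bigr => k _ do rewrite ffunE eqxx.
rewrite -(big_mkord (fun k => (0 < k < (L - n).+1)%N) (fun k => rule_eval (Delta Q k) g)).
rewrite -(big_nat_widen 0 (L - n).+1 L.+1 (fun k => 0 < k)%N); last by rewrite ltnS leq_subr.
rewrite big_mkcond big_nat_recl//= add0r.
under eq_bigr do rewrite rule_eval_Delta.
rewrite (telescope_sumr (fun k => rule_eval (level Q k) g))//= rule_eval_nil subr0.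
by case: (L - n)%N (subn_gt0 n L) => [|m]//; rewrite nL.
Qed.

End sparse_grid_of_coordinate_function.

(** * Counting the points of the sparse grid *)

Section grid_counting.
Context {R : realType}.
Context (Q : nat -> @rule R) (n : nat -> nat).
Context (uQ : forall l, (0 < l)%N -> uniq (nodes (Q l)))
  (sQ : forall l, (0 < l)%N -> size (nodes (Q l)) = n l).

(** Rules of different levels may share nodes.  Only every [K]-th level is used:
    for large [K] the node counts of these levels grow so fast that most nodes of
    each of them occur at no smaller level in use. *)
Definition new_nodes (K m : nat) : seq R :=
  [seq x <- nodes (Q (K * m)) |
     ~~ has (fun m' => x \in nodes (Q (K * m'))) (iota 1 m.-1)].

Lemma size_new_nodes K m : (0 < K)%N -> (0 < m)%N ->
  (n (K * m) <= size (new_nodes K m) + \sum_(1 <= m' < m) n (K * m'))%N.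
Proof.
move=> K0 m0; have Km : (0 < K * m)%N by rewrite muln_gt0 K0.
rewrite -sQ//.
rewrite -[X in (_ + X)%N](_ :
  size (flatten [seq nodes (Q (K * m')) | m' <- iota 1 m.-1]) = _); last first.
  rewrite size_flatten /shape -map_comp sumnE big_map /index_iota subn1.
  rewrite big_seq [RHS]big_seq; apply: eq_bigr => m'; rewrite mem_iota => /andP[m'0 _].
  by rewrite /= sQ// muln_gt0 K0.
rewrite -size_cat; apply: uniq_leq_size; first exact: uQ.
move=> x xm; rewrite mem_cat mem_filter xm andbT.
case: hasP => //= h; apply/flattenP; case: h => m' m'm xm'.
by exists (nodes (Q (K * m'))) => //; exact: map_f.
Qed.

Lemma new_nodes_disjoint K m m' x : (0 < m)%N -> (0 < m')%N ->
  x \in new_nodes K m -> x \in new_nodes K m' -> m = m'.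
Proof.
wlog mm' : m m' / (m <= m')%N.
  by move=> h m0 m'0 xm xm'; case/orP: (leq_total m m') => mm'; [|symmetry]; apply: h.
move=> m0 m'0; rewrite !mem_filter => /andP[_ xm] /andP[/hasPn nx _].
apply/eqP; rewrite eqn_leq mm' leqNgt; apply/negP => lt.
have : m \in iota 1 m'.-1 by rewrite mem_iota m0 add1n prednK.
by move/nx; rewrite xm.
Qed.

Section fixed_dimension.
Context (d L : nat).

Definition all_nodes : seq R := flatten [seq nodes (Q l) | l <- iota 0 L.+1].
Local Notation P := (seq_sub all_nodes).
Definition to_row (f : {ffun 'I_d -> P}) : 'rV[R]_d := \row_j ssval (f j).

Lemma to_row_inj : injective to_row.
Proof.
move=> f g /rowP fg; apply/ffunP => j; apply: val_inj.
by have := fg j; rewrite !mxE.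
Qed.

Lemma mem_all_nodes l x : (l <= L)%N -> x \in nodes (Q l) -> x \in all_nodes.
Proof.
move=> lL xl; apply/flattenP; exists (nodes (Q l)) => //.
by apply: (map_f (fun l => nodes (Q l))); rewrite mem_iota add0n ltnS.
Qed.

Lemma finite_grid_points : finite_set (grid_points Q (simplex_levels d L)).
Proof.
apply: (@sub_finite_set _ _ (to_row @` setT)); last first.
  by apply: finite_image; exact: finite_finset.
move=> x [l /= _ xl].
have xP j : x ord0 j \in all_nodes.
  by apply: mem_all_nodes (xl j); rewrite -ltnS.
exists [ffun j => SeqSub (xP j)] => //.
by apply/rowP => j; rewrite mxE ffunE.
Qed.

Lemma grid_size_ge (A : {set {ffun 'I_d -> P}}) :
  (forall f, f \in A -> grid_points Q (simplex_levels d L) (to_row f)) ->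
  (#|A| <= grid_size Q (simplex_levels d L))%N.
Proof.
move=> AG; rewrite cardE -(size_map to_row) /grid_size.
apply: uniq_leq_size; first by rewrite map_inj_uniq ?enum_uniq//; exact: to_row_inj.
move=> _ /mapP[f fA ->]; rewrite in_fset_set; last exact: finite_grid_points.
by rewrite inE; apply: AG; rewrite mem_enum in fA.
Qed.

Lemma grid_size_gt0 : (0 < d <= L)%N -> (0 < n 1)%N ->
  (0 < grid_size Q (simplex_levels d L))%N.
Proof.
move=> /andP[d0 dL] n1; have : (0 < size (nodes (Q 1)))%N by rewrite sQ.
case e : (nodes (Q 1)) => [//|x s] _.
have x1 : x \in nodes (Q 1) by rewrite e inE eqxx.
have xA : x \in all_nodes by exact: mem_all_nodes (leq_trans d0 dL) x1.
have L1 : (1 < L.+1)%N by rewrite ltnS (leq_trans d0).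
have := @grid_size_ge [set [ffun=> SeqSub xA]]%SET; rewrite cards1; apply.
move=> f; rewrite inE => /eqP ->; exists [ffun=> Ordinal L1].
  rewrite /= inE; apply/andP; split; first by apply/forallP => j; rewrite ffunE.
  by rewrite (eq_bigr (fun=> 1%N)) ?sum1_card ?card_ord// => j _; rewrite ffunE.
by move=> j; rewrite mxE !ffunE.
Qed.

Definition new_set K m : {set P} := [set x : P | ssval x \in new_nodes K m].

Lemma card_new_set K m : (0 < K)%N -> (0 < m)%N -> (K * m <= L)%N ->
  (size (new_nodes K m) <= #|new_set K m|)%N.
Proof.
move=> K0 m0 KmL; rewrite cardE -(size_map (@ssval _ _)).
apply: uniq_leq_size; first by rewrite filter_uniq// uQ// muln_gt0 K0.
move=> x xm; have xA : x \in all_nodes.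
  by apply: mem_all_nodes KmL _; move: xm; rewrite mem_filter => /andP[].
by apply/mapP; exists (SeqSub xA) => //; rewrite mem_enum inE.
Qed.

(** A point whose coordinates are new nodes determines its levels, so the products
    of the sets of new nodes are disjoint for different [m]. *)
Lemma grid_size_ge_sum K T (E : {set {ffun 'I_d -> 'I_T.+1}}) : (0 < K)%N -> (K * T <= L)%N ->
  (forall m, m \in E -> (forall j, 0 < m j)%N /\ (\sum_j m j <= T)%N) ->
  (\sum_(m in E) \prod_j #|new_set K (m j)| <= grid_size Q (simplex_levels d L))%N.
Proof.
move=> K0 KT hE.
pose B := [set mf : {ffun 'I_d -> 'I_T.+1} * {ffun 'I_d -> P} |
  (mf.1 \in E) && (mf.2 \in family (fun j => mem (new_set K (mf.1 j))))]%SET.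
have -> : (\sum_(m in E) \prod_j #|new_set K (m j)| = #|B|)%N.
  transitivity (\sum_(mf : {ffun 'I_d -> 'I_T.+1} * {ffun 'I_d -> P} |
    (mf.1 \in E) && (mf.2 \in family (fun j => mem (new_set K (mf.1 j))))) 1)%N.
    rewrite -(pair_big_dep (fun m => m \in E) (fun m (f : {ffun 'I_d -> P}) =>
      f \in family (fun j => mem (new_set K (m j)))) (fun _ _ => 1%N))/=.
    apply: eq_bigr => m _; rewrite sum1_card card_family foldrE big_image/=.
    by apply: eq_bigr.
  by rewrite -sum1_card; apply: eq_bigl => mf; rewrite [RHS]inE.
have sndI : {in B &, injective snd}.
  move=> [m f] [m' f']; rewrite !inE /= => /andP[mE /familyP fm] /andP[mE' /familyP fm'] ff'.
  subst f'; congr pair; apply/ffunP => j; apply: val_inj.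
  have := fm j; have := fm' j; rewrite !inE => h' h.
  by apply: (new_nodes_disjoint _ _ h h'); [exact: (hE _ mE).1|exact: (hE _ mE').1].
apply: (@leq_trans #|(snd @: B)%SET|); first by rewrite (card_in_imset sndI).
apply: grid_size_ge => _ /imsetP[[m f] + ->].
rewrite inE /= => /andP[mE /familyP fm]; have [m0 mT] := hE _ mE.
have KmL : (\sum_j K * m j <= L)%N by rewrite -big_distrr/=
  (leq_trans _ KT)// leq_mul2l mT orbT.
have KmjL j : (K * m j < L.+1)%N.
  by rewrite ltnS (leq_trans _ KmL)// (bigD1 j)//= leq_addr.
exists [ffun j => Ordinal (KmjL j)].
  rewrite /= inE; apply/andP; split.
    by apply/forallP => j; rewrite ffunE/= muln_gt0 K0 m0.
  by under eq_bigr do rewrite ffunE/=.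
move=> j; rewrite mxE ffunE /=.
by have := fm j; rewrite inE mem_filter => /andP[].
Qed.

End fixed_dimension.

Section growth.
Context (M M0 : R) (hM : 1 < M) (hM0 : 0 < M0)
  (hn : forall l, (0 < l)%N -> M ^+ (l - 1) <= (n l)%:R <= M0 * (M ^+ l - 1)).

(** With [q = M ^+ K], the level [K * m] has at least [q ^+ m / M] nodes, and all
    smaller levels in use have together at most half as many, by the geometric
    sum. *)
Lemma new_nodes_ge K m : (0 < K)%N -> (0 < m)%N -> 1 + 2 * M * M0 <= M ^+ K ->
  (M ^+ K) ^+ m / (2 * M) <= (size (new_nodes K m))%:R.
Proof.
move=> K0 m0; set q := M ^+ K => hq.
have Mp : 0 < M by rewrite (lt_trans _ hM).
have q1 : 1 < q by rewrite (lt_le_trans _ hq)// ltrDl !mulr_gt0.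
have Km (m' : nat) : (0 < m')%N -> (0 < K * m')%N by rewrite muln_gt0 K0.
have geo k : (q - 1) * \sum_(1 <= m' < k.+1) q ^+ m' <= q ^+ k.+1.
  elim: k => [|k IH]; first by rewrite big_geq// mulr0 exprn_ge0// ltW// (lt_trans _ q1).
  rewrite big_nat_recr//= mulrDr (le_trans (lerD IH (lexx _)))//.
  by rewrite [X in _ <= X]exprS; lra.
have := size_new_nodes K0 m0; rewrite -(ler_nat R) natrD natr_sum => h1.
have /andP[h2 _] := hn (Km _ m0).
have h3 : \sum_(1 <= m' < m) (n (K * m'))%:R <= M0 * \sum_(1 <= m' < m) q ^+ m'.
  rewrite mulr_sumr big_nat [X in _ <= X]big_nat; apply: ler_sum => m' /andP[m'0 _].
  have /andP[_ h] := hn (Km _ m'0); rewrite (le_trans h)// ler_pM2l// exprM.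
  by rewrite lerBlDr lerDl.
have h4 : M ^+ (K * m - 1) = q ^+ m / M.
  have := exprSr M (K * m - 1); rewrite -addn1 subnK ?Km// exprM => ->.
  by rewrite mulfK// gt_eqF.
have h5 : M0 * \sum_(1 <= m' < m) q ^+ m' <= q ^+ m / (2 * M).
  rewrite ler_pdivlMr ?mulr_gt0//.
  have := geo m.-1; rewrite prednK// => h; apply: le_trans h.
  have S0 : 0 <= \sum_(1 <= m' < m) q ^+ m'.
    by apply: sumr_ge0 => i _; rewrite exprn_ge0// ltW// (lt_trans _ q1).
  rewrite mulrAC ler_wpM2r//; lra.
have h6 : q ^+ m / M = q ^+ m / (2 * M) + q ^+ m / (2 * M).
  by field; rewrite gt_eqF.
move: (le_trans h2 h1); rewrite h4 h6; lra.
Qed.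

End growth.
End grid_counting.

(** With [t = T %/ e.+1], choose every part but the first freely between 1 and
    [t]; at least [t] remains for the first part. *)
Lemma compositions_lower_bound e T : (e < T)%N ->
  exists E : {set {ffun 'I_e.+1 -> 'I_T.+1}},
    #|E| = ((T %/ e.+1) ^ e)%N /\
    forall m, m \in E -> (forall j, 0 < m j)%N /\ (\sum_j m j = T)%N.
Proof.
move=> eT; set t := (T %/ e.+1)%N.
have t0 : (0 < t)%N by rewrite divn_gt0.
have tT : (e * t + t <= T)%N by rewrite -mulSnr mulnC leq_trunc_div.
pose S (h : {ffun 'I_e -> 'I_t}) := (\sum_i (h i).+1)%N.
have SE h : (S h <= e * t)%N.
  rewrite -[e in (_ <= e * _)%N]card_ord -sum_nat_const; apply: leq_sum => i _; exact: ltn_ord.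
have hT (h : {ffun 'I_e -> 'I_t}) i : ((h i).+1 < T.+1)%N.
  rewrite ltnS (leq_trans (ltn_ord _))// (leq_trans _ tT)// leq_addl//.
pose mu (h : {ffun 'I_e -> 'I_t}) : {ffun 'I_e.+1 -> 'I_T.+1} :=
  [ffun j => if fintype.unlift ord0 j is Some i then inord (h i).+1 else inord (T - S h)].
have mu0 h : mu h ord0 = (T - S h)%N :> nat.
  by rewrite ffunE fintype.unlift_none inordK// ltnS leq_subr.
have muS h i : mu h (fintype.lift ord0 i) = (h i).+1 :> nat.
  by rewrite ffunE fintype.liftK inordK.
exists (mu @: [set: {ffun 'I_e -> 'I_t}])%SET; split.
  rewrite card_imset ?cardsT ?card_ffun ?card_ord// => h h' /ffunP hh'.
  apply/ffunP => i; apply: val_inj.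
  by have /(congr1 val) := hh' (fintype.lift ord0 i); rewrite /= !muS => -[].
move=> _ /imsetP[h _ ->]; split=> [j|].
  case: (fintype.unliftP ord0 j) => [i ->|->]; first by rewrite muS.
  by rewrite mu0 subn_gt0 (leq_ltn_trans (SE h))// (leq_trans _ tT)// -addn1 leq_add2l.
rewrite big_ord_recl mu0 (eq_bigr (fun i => (h i).+1)) => [|i _]; last exact: muS.
by rewrite subnK// (leq_trans (SE h))// (leq_trans _ tT)// leq_addr.
Qed.

(** Bernoulli's inequality. *)
Lemma exists_expr_ge (R : realType) (M A : R) : 1 < M -> exists2 K, (0 < K)%N & A <= M ^+ K.
Proof.
move=> M1; have bern k : 1 + k%:R * (M - 1) <= M ^+ k.
  elim: k => [|k IH]; first by rewrite mul0r addr0 expr0.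
  have Mk : 1 <= M ^+ k by rewrite exprn_ege1// ltW.
  by rewrite exprS -natr1; nra.
pose k := (Num.truncn (`|A| / (M - 1))).+1; exists k => //.
rewrite (le_trans _ (bern k))//.
have M10 : 0 < M - 1 by rewrite subr_gt0.
have : `|A| / (M - 1) < k%:R by exact: truncnS_gt.
rewrite ltr_pdivrMr// => h; have := ler_norm A; lra.
Qed.

(** Keep the tuples of levels [K * m_j] with [\sum_j m_j = L %/ K].  Each of them
    contributes a multiple of [M ^+ L] points, and there are at least a multiple
    of [L ^ e] of them. *)
Lemma grid_size_growth (R : realType) (e : nat) (M M0 : R) : 1 < M -> 0 < M0 ->
  exists2 c : R, 0 < c & forall (Q : nat -> @rule R) (n : nat -> nat),
    (forall l, (0 < l)%N -> uniq (nodes (Q l))) ->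
    (forall l, (0 < l)%N -> size (nodes (Q l)) = n l) ->
    (forall l, (0 < l)%N -> M ^+ (l - 1) <= (n l)%:R <= M0 * (M ^+ l - 1)) ->
    forall L, (e < L)%N ->
      c * (M ^+ L * L%:R ^+ e) <= (grid_size Q (simplex_levels e.+1 L))%:R.
Proof.
move=> M1 M00; have [K K0 hK] := exists_expr_ge (1 + 2 * M * M0) M1.
have Mp : 0 < M by rewrite (lt_trans _ M1).
pose b : R := M ^+ (K * e.+1) * (2 * K * e.+1)%:R ^+ e * (2 * M) ^+ e.+1.
have c1 : 1 <= M ^+ (K * e.+1) by rewrite exprn_ege1// ltW.
have c2 : 1 <= (2 * K * e.+1)%:R ^+ e :> R.
  by rewrite exprn_ege1// ler1n !muln_gt0 K0.
have c3 : 1 <= (2 * M) ^+ e.+1 by rewrite exprn_ege1//; lra.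
have b0 : 0 < b by rewrite !mulr_gt0 ?exprn_gt0 ?ltr0n ?muln_gt0 ?K0 ?mulr_gt0.
exists b^-1 => [|Q n uQ sQ hn L eL]; first by rewrite invr_gt0.
rewrite mulrC ler_pdivrMr//.
(* For smaller [L] there may be no such tuple, but then the left-hand side is
   at most 1 by the choice of the constant. *)
have [LK|LK] := ltnP L (K * e.+1).
  have N1 : 1 <= (grid_size Q (simplex_levels e.+1 L))%:R :> R.
    rewrite ler1n; apply: (grid_size_gt0 sQ); first exact: eL.
    have /andP[h _] := hn 1%N isT; rewrite -(ltr_nat R).
    by apply: lt_le_trans h; rewrite subnn expr0.
  apply: (@le_trans _ _ (1 * b)); last by rewrite ler_wpM2r// ltW.
  rewrite mul1r /b -[X in X <= _]mulr1.
  apply: ler_pM => //; first by rewrite mulr_ge0// exprn_ge0// ltW.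
  apply: ler_pM => //; rewrite ?exprn_ge0// ?(ltW Mp)//.
    by rewrite ler_weXn2l ?(ltW M1)// ltnW.
  rewrite lerXn2r ?nnegrE// ler_nat (leq_trans (ltnW LK))// -mulnA leq_pmull//.
pose T := (L %/ K)%N; pose t := (T %/ e.+1)%N.
have eT : (e < T)%N by rewrite leq_divRL// mulnC.
have [E [cE hE]] := compositions_lower_bound eT.
have KT : (K * T <= L)%N by rewrite mulnC leq_trunc_div.
have hsum := @grid_size_ge_sum R Q e.+1 L K T E K0 KT.
have {}hsum := hsum (fun m mE => conj (hE m mE).1 (eq_leq (hE m mE).2)).
have hprod (m : {ffun 'I_e.+1 -> 'I_T.+1}) : m \in E ->
    M ^+ (K * T) / (2 * M) ^+ e.+1 <= (\prod_j #|new_set Q L K (m j)|)%:R.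
  move=> mE; have [m0 mT] := hE m mE.
  have -> : M ^+ (K * T) / (2 * M) ^+ e.+1 = \prod_(j < e.+1) ((M ^+ K) ^+ m j / (2 * M)).
    by rewrite prodf_div/= prodr_const card_ord -expr_sum mT exprM.
  rewrite natr_prod; apply: ler_prod => j _; apply/andP; split.
    by rewrite divr_ge0 ?exprn_ge0 ?mulr_ge0 ?(ltW Mp).
  rewrite (le_trans (new_nodes_ge uQ sQ M1 M00 hn K0 (m0 j) hK))// ler_nat card_new_set//.
  by rewrite (leq_trans _ KT)// leq_mul2l -ltnS ltn_ord orbT.
have hN : (t ^ e)%:R * (M ^+ (K * T) / (2 * M) ^+ e.+1) <=
    (grid_size Q (simplex_levels e.+1 L))%:R.
  move: hsum; rewrite -(ler_nat R); apply: le_trans.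
  rewrite natr_sum -cE mulr_natl -sumr_const; exact: ler_sum.
apply: (@le_trans _ _ ((t ^ e)%:R * (M ^+ (K * T) / (2 * M) ^+ e.+1) * b)); last first.
  by rewrite ler_wpM2r// ltW.
have tL : (L <= 2 * K * e.+1 * t)%N.
  have t0 : (0 < t)%N by rewrite divn_gt0.
  have : (L < (K * e.+1) * t.+1)%N.
    by rewrite /t /T -divnMA mulnC ltn_ceil// muln_gt0 K0.
  move/ltnW/leq_trans; apply.
  have -> : (2 * K * e.+1 * t = K * e.+1 * (2 * t))%N.
    by rewrite -!mulnA mulnCA [(2 * (e.+1 * t))%N]mulnCA.
  have t2 : (t.+1 <= 2 * t)%N by rewrite mul2n -addnn -addn1 leq_add2l.
  by rewrite leq_mul2l t2 orbT.
have -> : (t ^ e)%:R * (M ^+ (K * T) / (2 * M) ^+ e.+1) * b =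
    (M ^+ (K * T) * M ^+ (K * e.+1)) * ((2 * K * e.+1 * t)%:R ^+ e).
  have B0 : (2 * M) ^+ e.+1 != 0 by rewrite gt_eqF// exprn_gt0// mulr_gt0.
  rewrite /b (natrM _ (2 * K * e.+1)%N t) [(_ * _) ^+ e]exprMn natrX.
  move: B0 (_ ^+ e) (_ ^+ e) (M ^+ _) (M ^+ _).

  by set B := _ ^+ e.+1; move: B => B B0 x y z w; field.
apply: ler_pM; rewrite ?exprn_ge0// ?(ltW Mp)//; last first.
  by rewrite lerXn2r ?nnegrE// ler_nat.
rewrite -exprD ler_weXn2l ?(ltW M1)//.
have : (L < K * T.+1)%N by rewrite /T mulnC ltn_ceil.
move/ltnW/leq_trans; apply; rewrite mulnS addnC leq_add2l leq_pmulr//.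
Qed.

(** * The fooling function *)

Section derivative_families.
Context {R : realType}.

Lemma derive1n_family (F : nat -> R -> R) :
  (forall k (x : R), is_derive x 1 (F k) (F k.+1 x)) ->
  Coo (F 0%N) /\ forall k, derive1n k (F 0%N) = F k.
Proof.
move=> dF; split=> [m|k].
  by elim: m 0%N => [//|m IH] k; exists (F k.+1).
elim: k => [//|k IH]; rewrite derive1nS IH; apply/funext => x.
by rewrite derive1E; exact: derive_val.
Qed.

Lemma is_derive_sum_affine (I : Type) (r : seq I) (f f' : R -> R) 
    (c C : R) (b : I -> R) (x : R) :
  (forall y : R, is_derive y 1 f (f' y)) ->
  is_derive x 1 (fun x => \sum_(j <- r) C * f (c * x + b j))
    (\sum_(j <- r) (C * c) * f' (c * x + b j)).
Proof.
move=> df; elim: r => [|j r IH].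
  under eq_fun do rewrite big_nil; rewrite big_nil; exact: is_derive_cst.
under eq_fun do rewrite big_cons; rewrite big_cons.
apply: is_deriveD.
have da : is_derive x 1 (fun x : R => c * x + b j) c.
  have := is_deriveD (is_deriveZ c (is_derive_id x (1 : R))) (is_derive_cst (b j) x 1).
  by rewrite addr0 /GRing.scale/= mulr1.
have := is_deriveZ C (@is_derive1_comp _ f (fun x => c * x + b j) x _ _ (df _) da).
by rewrite /GRing.scale/= -mulrA [f' _ * c]mulrC.
Qed.

End derivative_families.

Section fooling_function.
Context {R : realType}.
Local Notation psi := (@bump R 1 0 1).
Local Notation pdf := (@normal_pdf R 0 1).
Context (m : nat) (e : 'I_m -> bool) (m0 : (0 < m)%N).
Let w : R := (2 * m)%:R.

(** The half of the [j]-th cell that carries the bump is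
    [[half j / (2 m), (half j + 1) / (2 m)]]: the left one if [e j] is [false]. *)
Definition half (j : 'I_m) : nat := (2 * j + e j)%N.

Definition fooling (x : R) : R := \sum_(j < m) psi (w * x - (half j)%:R).

Let w0 : 0 < w. Proof. by rewrite ltr0n muln_gt0. Qed.

Lemma half_inj : injective half.
Proof.
move=> i j /(congr1 (fun k => k./2)).
rewrite /half ![(2 * _)%N]mul2n ![(_.*2 + _)%N]addnC.
have hb (b : bool) (k : nat) : (b + k.*2)./2 = k by exact: half_bit_double.
by rewrite !hb => /val_inj.
Qed.

Lemma fooling_derive1n : Coo fooling /\ forall k x,
  derive1n k fooling x = \sum_(j < m) w ^+ k * derive1n k psi (w * x - (half j)%:R).
Proof.
pose F k x := \sum_(j < m) w ^+ k * derive1n k psi (w * x - (half j)%:R).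
have F0 : F 0%N = fooling.
  by apply/funext => x; apply: eq_bigr => j _; rewrite expr0 mul1r.
have [] := @derive1n_family R F.
  move=> k x; rewrite /F; under [X in is_derive _ _ _ X]eq_bigr do rewrite exprSr.
  apply: is_derive_sum_affine => y; apply: is_derive_derive1n; exact: Coo_bump.
by rewrite F0 => cF dF; split=> // k x; rewrite dF.
Qed.

(** The halves do not overlap, so at most one term of the sum is nonzero at [x]. *)
Lemma fooling_bound k C x : 0 <= C -> (forall y, `|derive1n k psi y| <= C) ->
  `|derive1n k fooling x| <= w ^+ k * C.
Proof.
move=> C0 hC; rewrite fooling_derive1n.2 -mulr_sumr normrM.
rewrite ger0_norm ?exprn_ge0 ?(ltW w0)// ler_wpM2l ?exprn_ge0 ?(ltW w0)//.
have psi0 y : ~~ (0 < y < 1) -> derive1n k psi y = 0.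
  by apply: derive1n_out; [exact: bump_out|exact: Coo_bump].
have [[j xj]|h] := pselect (exists j, 0 < w * x - (half j)%:R < 1).
  rewrite (bigD1 j)//= big1 ?addr0// => i ij; apply: psi0.
  apply: contra_neqN ij => xi; apply: half_inj.
  move: xi xj => /andP[h1 h2] /andP[h3 h4].
  have a1 : (half i)%:R < (half j)%:R + 1 :> R by lra.
  have a2 : (half j)%:R < (half i)%:R + 1 :> R by lra.
  rewrite natr1 ltr_nat ltnS in a1; rewrite natr1 ltr_nat ltnS in a2.
  by apply/eqP; rewrite eqn_leq a1.
rewrite big1 ?normr0// => j _; apply: psi0; apply/negP => xj; apply: h; by exists j.
Qed.

Lemma fooling_ge0 x : 0 <= fooling x.
Proof. by apply: sumr_ge0 => j _; exact: bump_ge0. Qed.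

Lemma pdf_ge (x : R) : 0 <= x <= 1 -> normal_peak 1 * expR (- (1 / 2)) <= pdf x.
Proof.
move=> /andP[x0 x1]; rewrite normal_pdfE ?oner_eq0//.
rewrite ler_wpM2l ?normal_peak_ge0// /normal_fun ler_expR subr0 expr1n mulNr lerN2.
rewrite -[1 *+ 2]/2; rewrite ler_wpM2r// expr_le1//.
Qed.

(** A lower bound of a bump on the middle half of its support, times a lower bound
    of the Gaussian density on [[0, 1]], times the total length of the middle
    halves. *)
Definition fooling_mass : R :=
  expR (- 8) * (normal_peak 1 * expR (- (1 / 2))) / 4.

Lemma fooling_mass_gt0 : 0 < fooling_mass.
Proof.
rewrite divr_gt0// mulr_gt0 ?expR_gt0// mulr_gt0 ?expR_gt0//.
by rewrite normal_peak_gt0// oner_eq0.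
Qed.

Lemma fooling_integral : fooling_mass <=
  \int[@lebesgue_measure R]_x (fooling x * pdf x).
Proof.
rewrite /fooling_mass; set kap := normal_peak 1 * _; set tau := expR _.
have tau0 : 0 <= tau by exact: expR_ge0.
have kap0 : 0 <= kap by rewrite mulr_ge0 ?expR_ge0 ?normal_peak_ge0.
have mpsi j : measurable_fun setT (fun x => psi (w * x - (half j)%:R)).
  have cpsi : continuous psi by exact: (@continuous_derive1n _ psi 0 (@Coo_bump _ _ _ _)).
  apply: (@measurableT_comp _ _ _ _ _ _ psi); first exact: continuous_measurable_fun.
  by apply: measurable_funB => //; exact: measurable_funM.
have mpdf := @measurable_normal_pdf R 0 1.
have mP j := measurable_funM (mpsi j) mpdf.
(* The middle half of the support of the [j]-th bump, where it is at least [tau]. *)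
pose I j : interval R := `[((half j)%:R + 4^-1) / w, ((half j)%:R + 3 / 4) / w].
have hj (j : 'I_m) : (half j)%:R + 1 <= w.
  rewrite natr1 ler_nat /half.
  have := ltn_ord j; rewrite -(leq_pmul2l (_ : 0 < 2)%N)// => h.
  apply: leq_trans h.
  by rewrite mulnS add2n ltnS -[X in (_ <= X)%N]addn1 leq_add2l; case: (e j).
have term j : ((tau * kap / (4 * m%:R))%:E <=
    \int[@lebesgue_measure R]_x (psi (w * x - (half j)%:R) * pdf x)%:E)%E.
  apply: (@le_trans _ _ (\int[@lebesgue_measure R]_(x in [set` I j]) (tau * kap)%:E)%E).
    rewrite integral_cst//= lebesgue_measure_itv/= lte_fin ltr_pM2r ?invr_gt0//.
    rewrite ifT; last by lra.
    rewrite -EFinB -EFinM lee_fin -mulrBl /w natrM.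
    rewrite le_eqVlt; apply/orP; left; apply/eqP; field.
    by rewrite pnatr_eq0 -lt0n.
  apply: (@le_trans _ _ (\int[@lebesgue_measure R]_(x in [set` I j])
    (psi (w * x - (half j)%:R) * pdf x)%:E)%E).
    apply: ge0_le_integral => //.
    - by move=> x _; rewrite lee_fin mulr_ge0.
    - by apply/measurable_EFinP; apply: measurable_funTS; exact: (mP j).
    move=> x; rewrite /I/= in_itv/= ler_pdivrMr// ler_pdivlMr// => /andP[x1 x2].
    have hj0 : 0 <= (half j)%:R :> R by [].
    rewrite lee_fin ler_pM//.
      by apply: bump_mid; rewrite mulrC; apply/andP; split; lra.
    apply: pdf_ge; apply/andP; split.
      by rewrite -(pmulr_lge0 _ w0); lra.
    by rewrite -(ler_pM2r w0) mul1r; have := hj j; lra.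
  apply: ge0_subset_integral => //.
    by apply/measurable_EFinP; exact: (mP j).
  by move=> x _; rewrite lee_fin mulr_ge0 ?bump_ge0 ?normal_pdf_ge0.
have sumE : (\int[@lebesgue_measure R]_x (fooling x * pdf x)%:E =
   \sum_(j < m) \int[@lebesgue_measure R]_x (psi (w * x - (half j)%:R) * pdf x)%:E)%E.
  rewrite -ge0_integral_sum//.
  - by apply: eq_integral => x _; rewrite mulr_suml sumEFin.
  - by move=> j; apply/measurable_EFinP; exact: (mP j).
  - by move=> j x _; rewrite lee_fin mulr_ge0 ?bump_ge0 ?normal_pdf_ge0.
have fin : (\int[@lebesgue_measure R]_x (fooling x * pdf x)%:E < +oo)%E.
  have [C C0 hC] := derive1n_bounded 0 (@bump_out R 1 0 1) (@Coo_bump R 1 0 1).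
  apply: (@le_lt_trans _ _ (\int[@lebesgue_measure R]_x (C%:E * (pdf x)%:E))%E).
    apply: ge0_le_integral => //.
    - by move=> x _; rewrite lee_fin mulr_ge0 ?fooling_ge0 ?normal_pdf_ge0.
    - apply/measurable_EFinP; apply: measurable_funM => //.
      exact: measurable_sum.
    - by apply/measurable_EFinP; exact: measurable_funM.
    move=> x _; rewrite -EFinM lee_fin ler_wpM2r ?normal_pdf_ge0//.
    by have := fooling_bound x C0 hC; rewrite expr0 mul1r; apply: le_trans; exact: ler_norm.
  rewrite ge0_integralZl//.
  - by rewrite integral_normal_pdf// mule1 ltry.
  - exact/measurable_EFinP.
  - by move=> x _; rewrite lee_fin normal_pdf_ge0.
rewrite /Rintegral -lee_fin fineK; last first.
  rewrite ge0_fin_numE//; apply: integral_ge0 => x _.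
  by rewrite lee_fin mulr_ge0 ?fooling_ge0 ?normal_pdf_ge0.
rewrite sumE (_ : (tau * kap / 4)%:E = (\sum_(j < m) (tau * kap / (4 * m%:R))%:E)%E).
  by apply: lee_sum => j _; exact: term.
rewrite sumEFin sumr_const card_ord; congr EFin; rewrite -mulr_natr; field.
by rewrite pnatr_eq0 -lt0n.
Qed.

End fooling_function.
Arguments fooling_mass {R}.

(** * The lower bound *)

Section lower_bound_ingredients.
Context {R : realType}.

(** If the left half of a cell contains a node then the right half does not, since
    a cell of width [1 / m] with two nodes would contradict the gap. *)
Lemma fooling_avoids (xs : seq R) (n m : nat) : (0 < m)%N -> (n <= m ^ 2)%N ->
  (forall x y, x \in xs -> y \in xs -> x != y -> 1 <= n%:R * (x - y) ^+ 2) ->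
  exists e : 'I_m -> bool, forall x, x \in xs -> fooling e x = 0.
Proof.
move=> m0 nm gap; pose w : R := (2 * m)%:R.
(* Leave the left half exactly when it contains a node. *)
pose e (j : 'I_m) := has (fun x => 0 < w * x - (2 * j)%:R < 1) xs.
exists e => x xxs; rewrite /fooling -/w big1// => j _; apply: bump_out; apply/negP.
rewrite /half natrD; case ej : (e j) => /= xj; last first.
  rewrite addr0 in xj.
  by move/hasPn : (negbT ej) => /(_ x xxs); rewrite xj.
have /hasP[y yxs yj] := ej.
have xy : x != y.
  by apply/eqP => exy; move: yj xj; rewrite exy => /andP[_ h1] /andP[h2 _]; lra.
have := gap x y xxs yxs xy; apply/negP; rewrite -ltNge.
apply: (@le_lt_trans _ _ (m%:R ^+ 2 * (x - y) ^+ 2)).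
  by rewrite ler_wpM2r ?sqr_ge0// -natrX ler_nat.
rewrite -exprMn -(ltr_pM2l (_ : 0 < 4 :> R))//.
have -> : 4 * (m%:R * (x - y)) ^+ 2 = (w * x - w * y) ^+ 2 by rewrite /w natrM; ring.
have -> : 4 * 1 = 2 ^+ 2 :> R by ring.
rewrite ltr_sqr ?nnegrE//; move: xj yj => /andP[h1 h2] /andP[h3 h4]; last by lra.
by lra.
Qed.

Lemma exists_sqrt_nat (n : nat) : (0 < n)%N ->
  exists2 m : nat, (0 < m)%N && (n <= m ^ 2)%N & m%:R <= 2 * Num.sqrt n%:R :> R.
Proof.
move=> n0; pose s : R := Num.sqrt n%:R; have s1 : 1 <= s.
  by rewrite -sqrtr1 ler_wsqrtr// ler1n.
exists (Num.truncn s).+1.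
  rewrite [X in X && _]/= -(ler_nat R n) natrX -[n%:R]sqr_sqrtr//= -/s.
  by rewrite lerXn2r ?nnegrE ?sqrtr_ge0//; exact/ltW/truncnS_gt.
rewrite -natr1 (_ : 2 * _ = s + s); last by rewrite /s; ring.
by rewrite lerD// truncn_le ?sqrtr_ge0.
Qed.

Lemma univariate_fooling (a : nat) : exists2 C : R, 0 < C &
  forall (n : nat) (q : @rule R), (0 < n)%N -> gauss_hermite n q ->
  exists g : R -> R, [/\ Coo g, forall x, 0 <= g x, rule_eval q g = 0,
    fooling_mass <=
      \int[@lebesgue_measure R]_x (g x * normal_pdf 0 1 x) &
    forall k y, (k <= a)%N -> `|derive1n k g y| <= C * Num.sqrt n%:R ^+ a].
Proof.
have hC k : exists C, 0 <= C /\ forall y : R, `|derive1n k (bump 1 0 1) y| <= C.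
  have [C C0 h] := derive1n_bounded k (@bump_out R 1 0 1) (@Coo_bump R 1 0 1).
  by exists C.
have [C Ch] := choice hC.
pose D := 1 + \sum_(k < a.+1) C k.
have CD k : (k <= a)%N -> C k <= D.
  move=> ka; rewrite /D (bigD1 (Ordinal (ka : (k < a.+1)%N)))//=.
  rewrite addrCA lerDl addr_ge0//; apply: sumr_ge0 => i _; exact: (Ch _).1.
have D0 : 0 < D by rewrite ltr_pwDl// sumr_ge0// => i _; exact: (Ch _).1.
exists (4 ^+ a * D) => [|n q n0 [sq uq rq _]]; first by rewrite mulr_gt0// exprn_gt0.
have [m /andP[m0 nm] ms] := exists_sqrt_nat n0.
have sn : size (nodes q) = n by rewrite size_map.
have gap x y : x \in nodes q -> y \in nodes q -> x != y -> 1 <= n%:R * (x - y) ^+ 2.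
  exact: (hermite_node_gap uq sn rq).
have [e he] := fooling_avoids m0 nm gap.
exists (fooling e); split.
- exact: (fooling_derive1n e).1.
- exact: fooling_ge0.
- by rewrite /rule_eval big_seq big1// => p pq; rewrite he ?mulr0// map_f.
- exact: fooling_integral.
move=> k y ka; have [Ck0 hCk] := Ch k.
rewrite (le_trans (fooling_bound e m0 y Ck0 hCk))//.
rewrite [X in _ <= X]mulrAC -exprMn.
apply: ler_pM; rewrite ?exprn_ge0//.
  have w1 : 1 <= (2 * m)%:R :> R by rewrite ler1n muln_gt0.
  rewrite (le_trans (ler_weXn2l w1 ka))// lerXn2r ?nnegrE ?mulr_ge0 ?sqrtr_ge0//.
  by rewrite natrM; lra.
exact: CD.
Qed.

Lemma exprD_le (e : nat) (x y : R) : 0 <= x -> 0 <= y ->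
  (x + y) ^+ e <= 2 ^+ e * (x ^+ e + y ^+ e).
Proof.
move=> x0 y0; wlog xy : x y x0 y0 / x <= y.
  by move=> h; case/orP: (le_total x y) => ?; [|rewrite addrC [x ^+ e + _]addrC]; apply: h.
apply: (@le_trans _ _ ((2 * y) ^+ e)).
  by rewrite lerXn2r ?nnegrE ?addr_ge0 ?mulr_ge0//; lra.
by rewrite exprMn ler_wpM2l ?exprn_ge0// lerDr exprn_ge0.
Qed.

(** With [y = N / M ^+ L] one has [ln N = ln y + L * ln M].  A power of [ln y] is at
    most a multiple of [y], and the power of [L] is absorbed by the growth of
    [N]. *)
Lemma log_rate (e : nat) (M c : R) : 1 < M -> 0 < c -> exists2 C, 0 < C &
  forall (L : nat) (N : R), 1 <= N -> c * (M ^+ L * L%:R ^+ e) <= N ->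
    M ^+ L * ln N ^+ e <= C * N.
Proof.
move=> M1 c0; have [B B0 hB] := horner_expR_bound ('X^e : {poly R}).
have Mp : 0 < M by rewrite (lt_trans _ M1).
have lM : 0 <= ln M by rewrite ln_ge0// ltW.
have lMe : 0 <= ln M ^+ e by rewrite exprn_ge0.
exists (2 ^+ e * (1 + B + ln M ^+ e / c)) => [|L N N1 cN].
  by rewrite mulr_gt0 ?exprn_gt0// ltr_wpDr ?divr_ge0 ?(ltW c0)// ltr_wpDr.
have N0 : 0 < N by rewrite (lt_le_trans _ N1).
have ML : 0 < M ^+ L by rewrite exprn_gt0.
have LM : ln (M ^+ L) = L%:R * ln M by rewrite lnXn// mulr_natl.
have ln0 : 0 <= ln N by rewrite ln_ge0.
have e3 : M ^+ L * (L%:R * ln M) ^+ e <= ln M ^+ e / c * N.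
  rewrite exprMn mulrA mulrC -mulrA ler_wpM2l// ler_pdivlMl//.
(* In this first case [ln N <= L * ln M], and [y] is not needed. *)
have [NM|MN] := leP N (M ^+ L).
  have lnN : ln N <= L%:R * ln M by rewrite -LM ler_ln.
  apply: (@le_trans _ _ (M ^+ L * (L%:R * ln M) ^+ e)).
    by rewrite ler_pM2l// lerXn2r ?nnegrE// mulr_ge0.
  rewrite (le_trans e3)// ler_wpM2r ?(ltW N0)//.
  have h1 : 1 <= 2 ^+ e :> R by rewrite exprn_ege1// ler1n.
  have h2 : 0 <= ln M ^+ e / c by rewrite divr_ge0// ltW.
  by nra.
set y := N / M ^+ L; have y1 : 1 <= y by rewrite ler_pdivlMr// mul1r ltW.
have y0 : 0 < y by rewrite (lt_le_trans _ y1).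
have lnN : ln N = ln y + L%:R * ln M by rewrite ln_div// LM subrK.
have lny : 0 <= ln y by rewrite ln_ge0.
have e1 : M ^+ L * ln y ^+ e <= B * N.
  have := hB _ lny; rewrite hornerXn ger0_norm ?exprn_ge0// lnK// => h.
  by rewrite mulrC -ler_pdivlMr// -mulrA.
rewrite lnN (le_trans (ler_wpM2l (ltW ML) (exprD_le e lny (mulr_ge0 (ler0n _ L) lM))))//.
rewrite mulrCA -mulrA ler_wpM2l ?exprn_ge0// mulrDr [X in _ <= X]mulrDl lerD//.
by rewrite (le_trans e1)// ler_wpM2r ?(ltW N0)//; lra.
Qed.

End lower_bound_ingredients.

Lemma rate_factor (R : realType) (a e : nat) (N C ML : R) : 1 <= N -> 0 < ML ->
  ML * ln N ^+ e <= C * N ->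
  (N `^ (- (a%:R / 2)) * ln N `^ (a%:R / 2 * (e.+1%:R - 1))) * Num.sqrt ML ^+ a
    <= Num.sqrt C ^+ a.
Proof.
move=> N1 ML0 hC.
have N0 : 0 < N by rewrite (lt_le_trans _ N1).
have l0 : 0 <= ln N by rewrite ln_ge0.
have sE x : 0 <= x -> Num.sqrt x ^+ a = x `^ (a%:R / 2).
  by move=> x0; rewrite -powR12_sqrt// -powR_mulrn ?powR_ge0// -powRrM mulrC.
have C0 : 0 <= C.
  rewrite -(pmulr_lge0 _ N0); apply: le_trans hC.
  by rewrite mulr_ge0 ?exprn_ge0// ltW.
rewrite sE ?(ltW ML0)// sE//.
have -> : a%:R / 2 * (e.+1%:R - 1) = e%:R * (a%:R / 2) :> R.
  by rewrite -[e.+1%:R]natr1 addrK mulrC.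
rewrite powRrM powR_mulrn// powRN -mulrA ler_pdivrMl ?powR_gt0//.
have le0 : 0 <= ln N ^+ e by rewrite exprn_ge0.
rewrite -!powRM ?(ltW ML0) ?(ltW N0)//.
apply: ge0_ler_powR; rewrite ?nnegrE ?mulr_ge0 ?(ltW ML0) ?(ltW N0)//.
by rewrite mulrC [N * C]mulrC.
Qed.

Theorem theorem3p2 (R : realType) (a d : nat) (M0 M : R)
    (ha : (0 < a)%N) (hd : (0 < d)%N) (hM0 : 0 < M0) (hM : 1 < M) :
  exists2 c : R, 0 < c &
    forall (n : nat -> nat) (Q : nat -> @rule R),
      (forall l, (0 < l)%N -> gauss_hermite (n l) (Q l)) ->
      (forall l l', (0 < l)%N -> (0 < l')%N -> l <> l' -> n l <> n l') ->
      (forall l, (0 < l)%N ->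
        M ^+ (l - 1) <= (n l)%:R <= M0 * (M ^+ l - 1)) ->
      forall L : nat, (d <= L)%N ->
        let Lam := simplex_levels d L in
        let N : R := (grid_size Q Lam)%:R in
        ((c * N `^ (- (a%:R / 2)) * ln N `^ (a%:R / 2 * (d%:R - 1)))%:E <=
         worst_case_error a (sparse_quad Q Lam))%E.
Proof.
case: d hd => [//|e] _.
have Mp : 0 < M by rewrite (lt_trans _ hM).
have [c1 c10 growth] := grid_size_growth e hM hM0.
have [C2 C20 rate] := log_rate e hM c10.
have [C C0 fool] := @univariate_fooling R a.
pose c0 : R := fooling_mass; have c00 : 0 < c0 := fooling_mass_gt0.
pose K : R := Num.sqrt #|{: {ffun 'I_e.+1 -> 'I_a.+1}}|%:R.
have K0 : 0 < K by rewrite sqrtr_gt0 ltr0n card_ffun expn_gt0 card_ord.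
pose D := K * (C * (Num.sqrt M0 ^+ a * Num.sqrt C2 ^+ a)).
have D0 : 0 < D.
  by rewrite mulr_gt0// mulr_gt0// mulr_gt0// exprn_gt0// sqrtr_gt0.
exists (c0 / D); first exact: divr_gt0.
move=> n Q hQ _ hn L eL; cbv zeta.
set Lam := simplex_levels _ L; set N : R := (grid_size Q Lam)%:R.
have n0 l : (0 < l)%N -> (0 < n l)%N.
  move=> l0; have /andP[h _] := hn l l0; rewrite -(ltr_nat R).
  by apply: lt_le_trans h; rewrite exprn_gt0.
have uQ l : (0 < l)%N -> uniq (nodes (Q l)) by move=> /hQ[].
have sQ l : (0 < l)%N -> size (nodes (Q l)) = n l by move=> /hQ[]; rewrite size_map.
have Q1 l : (0 < l)%N -> rule_eval (Q l) (cst 1) = 1.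
  move=> l0; have [_ _ _ /(_ 1)] := hQ l l0.
  rewrite size_poly1 muln_gt0 n0// => /(_ isT).
  under eq_fun do rewrite hornerC; move=> ->.
  under eq_Rintegral do rewrite hornerC mul1r.
  by rewrite /Rintegral integral_normal_pdf.
have N1 : 1 <= N.
  by rewrite ler1n; apply: (grid_size_gt0 sQ) => //; rewrite n0.
have ML0 : 0 < M ^+ L by rewrite exprn_gt0.
have hrate := rate L N N1 (growth Q n uQ sQ hn L eL).
pose l := (L - e)%N; have l0 : (0 < l)%N by rewrite subn_gt0.
have [g [cg g0 Qg Ig gB]] := fool (n l) (Q l) (n0 l l0) (hQ l l0).
have S0 : sparse_quad Q Lam (fun x : 'rV[R]_e.+1 => g (x ord0 ord0)) = 0.
  by rewrite sparse_quad_fst.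
have I0 := lt_le_trans c00 Ig.
apply: le_trans (worst_case_error_fst cg g0 gB I0 S0).
rewrite lee_fin -/K.
have sn0 : 0 < Num.sqrt (n l)%:R ^+ a :> R by rewrite exprn_gt0// sqrtr_gt0 ltr0n n0.
rewrite ler_pdivlMr ?mulr_gt0//; apply: le_trans Ig; rewrite -/c0.
have nM : (n l)%:R <= M0 * M ^+ L.
  have /andP[_ h] := hn l l0; rewrite (le_trans h)// ler_pM2l//.
  rewrite (@le_trans _ _ (M ^+ l))//; first by rewrite lerBlDr lerDl.
  by rewrite ler_weXn2l ?(ltW hM)// leq_subr.
have sn : Num.sqrt (n l)%:R ^+ a <= Num.sqrt M0 ^+ a * Num.sqrt (M ^+ L) ^+ a.
  rewrite -exprMn -sqrtrM ?(ltW hM0)// lerXn2r ?nnegrE ?sqrtr_ge0//.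
  by rewrite ler_wsqrtr.
have := rate_factor a N1 ML0 hrate.
set X := N `^ _ * _ => hX.
have X0 : 0 <= X by rewrite mulr_ge0 ?powR_ge0.
have P0 : 0 < Num.sqrt M0 ^+ a by rewrite exprn_gt0// sqrtr_gt0.
have S1 : 0 < Num.sqrt C2 ^+ a by rewrite exprn_gt0// sqrtr_gt0.
have key : X * Num.sqrt (n l)%:R ^+ a <= Num.sqrt M0 ^+ a * Num.sqrt C2 ^+ a.
  apply: (@le_trans _ _ (X * (Num.sqrt M0 ^+ a * Num.sqrt (M ^+ L) ^+ a))).
    by rewrite ler_wpM2l.
  by rewrite mulrCA ler_wpM2l// ltW.
rewrite -mulrA -/X.
have -> : c0 / D * X * (K * (C * Num.sqrt (n l)%:R ^+ a)) =
    c0 * (X * Num.sqrt (n l)%:R ^+ a / (Num.sqrt M0 ^+ a * Num.sqrt C2 ^+ a)).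
  rewrite /D; move: P0 S1; set P := Num.sqrt M0 ^+ a; set S := Num.sqrt C2 ^+ a.
  by move=> P0 S1; field; rewrite !gt_eqF.
by rewrite ler_piMr ?(ltW c00)// ler_pdivrMr ?mul1r// mulr_gt0.
Qed.
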